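(* Let $P_1$ and $P_2$ be real constant coefficient ordinary differential operators of orders $n_1\ge 2$ and $n_2\ge 2$, with associated curves $\sigma_1,\sigma_2$ and associated surface $\Sigma(t_1,t_2)=\sigma_1(t_1)\otimes\sigma_2(t_2)$ in $\mathbb{R}^{n_1n_2}$. If all the roots of the characteristic polynomials $\mathcal{P}_1$ and $\mathcal{P}_2$ are simple and if the real roots are dominant, then $$0=K[\Sigma]-2\Theta[\sigma_1]-2\Theta[\sigma_2]+2\pi .$$
   Context: For $i=1,2$ let $P_i(\phi)=\phi^{(n_i)}+c_{i,n_i-1}\phi^{(n_i-1)}+\dots+c_{i,0}\phi$ be a real constant coefficient ordinary differential operator of order $n_i\ge2$ with characteristic polynomial $\mathcal{P}_i(\lambda)=\lambda^{n_i}+c_{i,n_i-1}\lambda^{n_i-1}+\dots+c_{i,0}$ and set of complex roots $\mathcal{R}_i$. Assume all roots are simple. Write $\mathcal{R}_1=\{r_1,\dots,r_k,x_1\pm y_1\sqrt{-1},\dots,x_p\pm y_p\sqrt{-1}\}$ and $\mathcal{R}_2=\{s_1,\dots,s_\ell,z_1\pm w_1\sqrt{-1},\dots,z_q\pm w_q\sqrt{-1}\}$, where $r_1>\dots>r_k$ and $s_1>\dots>s_\ell$ are the real roots and $y_j,w_j>0$. Define $\sigma_1(t_1)=(e^{r_1t_1},\dots,e^{r_kt_1},e^{x_1t_1}\cos(y_1t_1),e^{x_1t_1}\sin(y_1t_1),\dots)\in\mathbb{R}^{n_1}$ and $\sigma_2(t_2)=(e^{s_1t_2},\dots,e^{s_\ell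 t_2},e^{z_1t_2}\cos(w_1t_2),e^{z_1t_2}\sin(w_1t_2),\dots)\in\mathbb{R}^{n_2}$. The surface is $\Sigma(t_1,t_2)=\sigma_1(t_1)\otimes\sigma_2(t_2)\in\mathbb{R}^{n_1}\otimes\mathbb{R}^{n_2}=\mathbb{R}^{n_1n_2}$, i.e. its coordinates are all products of a coordinate of $\sigma_1(t_1)$ with a coordinate of $\sigma_2(t_2)$; all spaces carry the standard Euclidean inner product, extended to the exterior algebra by $(u_1\wedge u_2,v_1\wedge v_2)=\det((u_i,v_j))$. ''The real roots are dominant'' means: $r_1>0$ and $r_1>\Re(\mu)$ for all $\mu\in\mathcal{R}_1\setminus\{r_1\}$; $r_k<0$ and $r_k<\Re(\mu)$ for all $\mu\in\mathcal{R}_1\setminus\{r_k\}$; $s_1>0$ and $s_1>\Re(\mu)$ for all $\mu\in\mathcal{R}_2\setminus\{s_1\}$; $s_\ell<0$ and $s_\ell<\Re(\mu)$ for all $\mu\in\mathcal{R}_2\setminus\{s_\ell\}$. (Under these hypotheses $\Sigma$ is an immersion.) Total Gauss curvature: $K[\Sigma]=\int_{\mathbb{R}^2}K\,g\,dt_1dt_2$, where $g_{ij}=(\partial_{t_i}\Sigma,\partial_{t_j}\Sigma)$, $g=\sqrt{g_{11}g_{22}-g_{12}^2}$, and $K$ is the Gauss curvature of the induced metric. For a curve $\sigma$ with $\sigma\wedge\dot\sigma\ne0$ everywhere, $$\Theta[\sigma]:=\int_{-\infty}^\infty\frac{(\dot\sigma(t)\wedge\sigma(t),\dot\sigma(t)\wedge\ddot\sigma(t))}{\|\dot\sigma(t)\wedge\sigma(t)\|\cdot\|\dot\sigma(t)\|^2}\,dt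 .$$ Under the hypotheses, the integrals defining $K[\Sigma]$, $\Theta[\sigma_1]$ and $\Theta[\sigma_2]$ converge absolutely. *)

(* Defs.v *)
From HB Require Import structures.
From mathcomp Require Import all_boot all_order all_algebra.
From mathcomp.real_closed Require Import complex.
From mathcomp Require Import all_classical all_reals all_analysis.

Set Implicit Arguments.
Unset Strict Implicit.
Unset Printing Implicit Defensive.

Import Order.TTheory GRing.Theory Num.Theory.
Import numFieldNormedType.Exports.

Local Open Scope classical_set_scope.
Local Open Scope complex_scope.
Local Open Scope ring_scope.

Section Operators.
Variable R : realType.

(* The operator phi |-> phi^(n) + c_(n-1) phi^(n-1) + ... + c_0 phi of order n,
   given by its lower coefficients c_0, ..., c_(n-1). *)
Record ode_operator (n : nat) := ODEOperator { ode_coef : 'I_n -> R }.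

Definition ode_apply n (P : ode_operator n) (phi : R -> R) : R -> R :=
  fun t => derive1n n phi t + \sum_(i < n) ode_coef P i * derive1n i phi t.

Definition charpoly n (P : ode_operator n) : {poly R} :=
  'X^n + \sum_(i < n) ode_coef P i *: 'X^i.

Definition ccharpoly n (P : ode_operator n) : {poly R[i]} :=
  map_poly (real_complex R) (charpoly P).

Definition roots_set n (P : ode_operator n) : set R[i] :=
  [set z | root (ccharpoly P) z].

Definition all_roots_simple n (P : ode_operator n) : Prop :=
  forall z, roots_set P z -> mup z (ccharpoly P) = 1%N.

(* r lists the real roots in decreasing order, and (x, y) lists without
   repetition one root x_j + y_j i, y_j > 0, of each conjugate pair of
   non-real roots (the order of the pairs is arbitrary). *)
Definition roots_listing n (P : ode_operator n) k p
    (r : 'I_k -> R) (x y : 'I_p -> R) : Prop :=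
  [/\ forall i j : 'I_k, (i < j)%N -> r j < r i,
      forall j, 0 < y j,
      injective (fun j => (x j, y j)) &
      roots_set P = [set (r i)%:C | i in [set: 'I_k]]
        `|` [set x j +i* y j | j in [set: 'I_p]]
        `|` [set x j -i* y j | j in [set: 'I_p]] ].

(* [first] and [last] are forced to be the indices of the largest and of the
   smallest real root; in particular there is at least one real root. *)
Definition real_roots_dominant n (P : ode_operator n) k (r : 'I_k -> R) : Prop :=
  exists first last : 'I_k,
    [/\ first = 0%N :> nat, last = k.-1 :> nat,
        0 < r first
        /\ (forall mu, roots_set P mu -> mu <> (r first)%:C ->
              complex.Re mu < r first) &
        r last < 0
        /\ (forall mu, roots_set P mu -> mu <> (r last)%:C ->
              r last < complex.Re mu) ].

End Operators.

Section Geometry.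
Variable R : realType.

(* The Euclidean inner product; the norm `|_| of 'rV[R]_n is the sup norm. *)
Definition dotp n (u v : 'rV[R]_n) : R := \sum_j u 0 j * v 0 j.

Definition enorm n (u : 'rV[R]_n) : R := Num.sqrt (dotp u u).

(* (u1 /\ u2, v1 /\ v2) *)
Definition wedge_dotp n (u1 u2 v1 v2 : 'rV[R]_n) : R :=
  \det (\matrix_(i < 2, j < 2)
          dotp (if i == 0 then u1 else u2) (if j == 0 then v1 else v2)).

Definition wedge_norm n (u1 u2 : 'rV[R]_n) : R :=
  Num.sqrt (wedge_dotp u1 u2 u1 u2).

Definition Theta_integrand n (sigma : R -> 'rV[R]_n) (t : R) : R :=
  let s := sigma t in
  let ds := derive1 sigma t in
  let dds := derive1n 2 sigma t in
  wedge_dotp ds s ds dds / (wedge_norm ds s * enorm ds ^+ 2).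

(* Theta and total_gauss_curvature are Lebesgue integrals with values in \bar R,
   where oo - oo = -oo: a sum of them can equal a real number only if each of
   the integrals converges absolutely. *)
Definition Theta n (sigma : R -> 'rV[R]_n) : \bar R :=
  (\int[lebesgue_measure]_t (Theta_integrand sigma t)%:E)%E.

(* The derivative of F in the i-th of the variables (t1, t2). *)
Definition pderiv (V : normedModType R) (i : 'I_2) (F : R -> R -> V)
    (t1 t2 : R) : V :=
  if i == 0 then derive1 (F ^~ t2) t1 else derive1 (F t1) t2.

Definition metric := R -> R -> 'M[R]_2.

Definition induced_metric n (S : R -> R -> 'rV[R]_n) : metric :=
  fun t1 t2 => \matrix_(i < 2, j < 2)
    dotp (pderiv i S t1 t2) (pderiv j S t1 t2).

Definition area_density (g : metric) (t1 t2 : R) : R :=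
  Num.sqrt (g t1 t2 0 0 * g t1 t2 1 1 - g t1 t2 0 1 ^+ 2).

(* Gamma^l_ij
   = 1/2 sum_m g^lm (d_i g_jm + d_j g_im - d_m g_ij) *)
Definition christoffel (g : metric) (l i j : 'I_2) (t1 t2 : R) : R :=
  2^-1 * \sum_(m < 2) invmx (g t1 t2) l m *
    (pderiv i (fun u v => g u v j m) t1 t2
     + pderiv j (fun u v => g u v i m) t1 t2
     - pderiv m (fun u v => g u v i j) t1 t2).

(* The components of the curvature tensor with
   R(d_i, d_j) d_k = sum_l R^l_kij d_l,
   R(X, Y) = nabla_X nabla_Y - nabla_Y nabla_X - nabla_[X, Y]. *)
Definition riemann (g : metric) (l k i j : 'I_2) (t1 t2 : R) : R :=
  pderiv i (christoffel g l j k) t1 t2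
  - pderiv j (christoffel g l i k) t1 t2
  + \sum_(m < 2)
      (christoffel g l i m t1 t2 * christoffel g m j k t1 t2
       - christoffel g l j m t1 t2 * christoffel g m i k t1 t2).

(* (R(d_1, d_2) d_2, d_1) / (g_11 g_22 - g_12^2), which is 1 on the unit
   sphere. *)
Definition gauss_curvature (g : metric) (t1 t2 : R) : R :=
  (\sum_(l < 2) g t1 t2 0 l * riemann g l 1 0 1 t1 t2) / \det (g t1 t2).

Definition total_gauss_curvature n (S : R -> R -> 'rV[R]_n) : \bar R :=
  let g := induced_metric S in
  (\int[lebesgue_measure \x lebesgue_measure]_t
     (gauss_curvature g t.1 t.2 * area_density g t.1 t.2)%:E)%E.

End Geometry.

Section CurvesAndSurface.
Variable R : realType.

(* (e^(r_1 t), ..., e^(r_k t), e^(x_1 t) cos(y_1 t), e^(x_1 t) sin(y_1 t), ...);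
   mxvec lists the entries of a matrix row by row. *)
Definition assoc_curve k p (r : 'I_k -> R) (x y : 'I_p -> R) (t : R)
    : 'rV[R]_(k + p * 2) :=
  row_mx (\row_j expR (r j * t))
    (mxvec (\matrix_(j < p, b < 2)
      (expR (x j * t) * (if b == 0 then cos (y j * t) else sin (y j * t))))).

Definition tensor m n (u : 'rV[R]_m) (v : 'rV[R]_n) : 'rV[R]_(m * n) :=
  mxvec (u^T *m v).

Definition assoc_surface m n (sigma1 : R -> 'rV[R]_m) (sigma2 : R -> 'rV[R]_n)
    (t1 t2 : R) : 'rV[R]_(m * n) :=
  tensor (sigma1 t1) (sigma2 t2).

End CurvesAndSurface.

Section AmbientDimension.
Variable R : realType.

Lemma size_charpoly n (P : ode_operator R n) : size (charpoly P) = n.+1.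
Proof.
rewrite /charpoly size_polyDl size_polyXn // ltnS.
apply: (leq_trans (size_sum _ _ _)).
apply/bigmax_leqP => i _.
by rewrite (leq_trans (size_scale_leq _ _)) // size_polyXn.
Qed.

Lemma monic_charpoly n (P : ode_operator R n) : charpoly P \is monic.
Proof.
rewrite /charpoly monicE lead_coefDl ?lead_coefXn // size_polyXn ltnS.
apply: (leq_trans (size_sum _ _ _)).
apply/bigmax_leqP => i _.
by rewrite (leq_trans (size_scale_leq _ _)) // size_polyXn.
Qed.

(* The curve of an operator of order n with simple roots lives in R^n. *)
Lemma roots_listing_dim n (P : ode_operator R n) k p
    (r : 'I_k -> R) (x y : 'I_p -> R) :
  all_roots_simple P -> roots_listing P r x y -> (k + p * 2)%N = n.
Proof.
move=> simpleP [r_dec y_gt0 xy_inj rootsP].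
set Q := ccharpoly P.
have Qmonic : Q \is monic by rewrite map_monic monic_charpoly.
have sQ : size Q = n.+1 by rewrite size_map_poly size_charpoly.
have [s Qs] := closed_field_poly_normal Q.
rewrite (monicP Qmonic) scale1r in Qs.
have s_size : size s = n.
  by apply: succn_inj; rewrite -sQ Qs size_prod_XsubC.
have root_s z : root Q z = (z \in s) by rewrite Qs root_prod_XsubC.
have s_uniq : uniq s.
  apply/count_mem_uniq => z; case zs: (z \in s); last first.
    by apply/count_memPn; rewrite zs.
  have := simpleP z; rewrite /roots_set /= root_s zs -/Q Qs mu_prod_XsubC.
  exact.
pose l := [seq (r i)%:C | i : 'I_k] ++
  ([seq x j +i* y j | j : 'I_p] ++ [seq x j -i* y j | j : 'I_p]).
have l_uniq : uniq l.
  have r_inj : injective r.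
    move=> i j rij; apply: val_inj; case: (ltngtP i j) => // ij.
      by have := r_dec _ _ ij; rewrite rij ltxx.
    by have := r_dec _ _ ij; rewrite rij ltxx.
  have yN0 j : y j <> 0 by move/eqP; rewrite gt_eqF.
  have c_inj : injective (fun i => (r i)%:C) by move=> i j [/r_inj].
  have p_inj : injective (fun j => x j +i* y j).
    by move=> i j [xE yE]; apply: xy_inj; rewrite xE yE.
  have m_inj : injective (fun j => x j -i* y j).
    by move=> i j [xE /oppr_inj yE]; apply: xy_inj; rewrite xE yE.
  rewrite !cat_uniq (map_inj_uniq c_inj) (map_inj_uniq p_inj).
  rewrite (map_inj_uniq m_inj) !enum_uniq /= andbT.
  apply/andP; split; apply/hasPn => z.
    rewrite mem_cat => /orP[] /mapP[j _ ->]; apply/mapP => -[i _ []] _ //.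
      exact: yN0.
    by move/eqP; rewrite oppr_eq0 => /eqP; exact: yN0.
  move=> /mapP[j _ ->]; apply/mapP => -[i _ []] _ yE.
  by have := y_gt0 i; rewrite -yE oppr_gt0 ltNge ltW.
have s_l : s =i l.
  move=> z; rewrite -root_s; apply/idP/idP => [zQ|].
    have : roots_set P z by [].
    rewrite rootsP !mem_cat => -[[]|] [j _ <-]; apply/or3P.
    - by apply: Or31; apply/mapP; exists j; rewrite ?mem_enum.
    - by apply: Or32; apply/mapP; exists j; rewrite ?mem_enum.
    - by apply: Or33; apply/mapP; exists j; rewrite ?mem_enum.
  suff : z \in l -> roots_set P z by [].
  rewrite rootsP !mem_cat => /orP[|/orP[]] /mapP[j _ ->].
  - by left; left; exists j.
  - by left; right; exists j.
  - by right; exists j.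
rewrite -s_size (perm_size (uniq_perm s_uniq l_uniq s_l)).
by rewrite !size_cat !size_image !card_ord muln2 addnn.
Qed.

End AmbientDimension.

(* Main.v *)
(** Write A, C, B for the inner products (s,s), (s,s'), (s',s') of the first
    curve, W = AB - C^2 for its squared area |s /\ s'|^2 and T for the numerator
    of the integrand of Theta; let D, F, E, W', T' be the same quantities for
    the second curve.  The induced metric has g11 = BD, g12 = CF, g22 = AE,
    hence determinant G = ABDE - C^2 F^2 = W DE + C^2 W', and a computation gives

      K sqrt G = (A T D T' - B W E W') / G^(3/2)
               = (T / B) d_v (F / sqrt G) - (W' / D) d_u (C / sqrt G).

    With s' = s M one has |T| <= c W, and dominance gives W <= c A B exp(-d|t|);
    since G dominates both W DE and AB W', each of the two terms is
    absolutely integrable over the plane.  Dominance also gives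
    F / sqrt G -> +-1 / sqrt W as v -> +-oo, so that by Fubini the first term
    contributes 2 Theta[s1] and the second -2 \int sqrt W' / D.  Finally
    sqrt W' / D + T' / (E sqrt W') is the derivative of atan (F / sqrt W'),
    which runs from -pi/2 to pi/2. *)
From HB Require Import structures.
Require Import Defs.
From mathcomp Require Import all_boot all_order all_algebra.
From mathcomp.real_closed Require Import complex.
From mathcomp Require Import all_classical all_reals all_analysis.
From mathcomp Require Import measurable_realfun.
From mathcomp Require Import ring lra.

Set Implicit Arguments.
Unset Strict Implicit.
Unset Printing Implicit Defensive.

Import Order.TTheory GRing.Theory Num.Theory.
Import numFieldNormedType.Exports.

Local Open Scope classical_set_scope.
Local Open Scope ring_scope.

(** * Integration over the line *)

(** The products [A T D T'] and [B W E W'] are not integrated separately: adding and subtracting the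
    cross term [A T E W'] turns each numerator into a coefficient in one variable times an exact
    derivative in the other. The obstacle is joint decay. Each of the two lower bounds on G yields
    an estimate that decays in one variable and is only bounded in the other; their geometric mean
    decays in both. Hence the decay is carried by the square of an integrable profile [bell], so
    that one power is left after the square root. The bound |T| <= c W is exterior algebra: s' /\
    s'' is the image of s /\ s' under the second exterior power of M, so T is a quadratic form in
    the coordinates of s /\ s'. The decay of W / (A B) comes from antisymmetry: the product of a
    dominant exponential with itself never enters a minor. Geometrically, F / sqrt W' is the
    cotangent of the angle between s and s', which falls from pi to 0 along the curve. *)

Section RealLine.
Variable R : realType.
Implicit Types (f g F : R -> R) (a b c : R).
Notation mu := (@lebesgue_measure R).

Lemma continuous_integral_itv f F a b : a < b -> continuous f ->
  (forall x : R, is_derive x 1 F (f x)) ->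
  (\int[mu]_(x in `[a, b]) (f x)%:E = (F b - F a)%:E)%E.
Proof.
move=> ab cf dF.
have cF : continuous F.
  move=> x; apply/differentiable_continuous/derivable1_diffP.
  by have := dF x.
rewrite EFinB; apply: continuous_FTC2 => //.
- exact: continuous_subspaceT.
- split.
  + by move=> x _; have := dF x.
  + exact/cvg_at_right_filter/cF.
  + exact/cvg_at_left_filter/cF.
- by move=> x _; rewrite derive1E; exact: derive_val.
Qed.

(** The shift to n + 1 keeps every box nondegenerate, as [continuous_integral_itv] demands. *)
Let box (n : nat) : set R := `[- n.+1%:R, n.+1%:R].

Let near_box (x : R) : \forall n \near \oo, box n x.
Proof.
near=> n.
rewrite /box /= in_itv/= -ler_norml.
rewrite (@le_trans _ _ n%:R) ?ler_nat//.
near: n; exact: nbhs_infty_ger.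
Unshelve. all: by end_near. Qed.

Let box_lt n : (- n.+1%:R : R) < n.+1%:R.
Proof. by rewrite gtrN ?ltr0n. Qed.

Lemma integral_setT_FTC f F a b : continuous f ->
  mu.-integrable setT (EFin \o f) ->
  (forall x : R, is_derive x 1 F (f x)) ->
  F x @[x --> -oo] --> a -> F x @[x --> +oo] --> b ->
  (\int[mu]_x (f x)%:E = (b - a)%:E)%E.
Proof.
move=> cf fi dF Fa Fb.
have mf : measurable_fun setT f by exact: continuous_measurable_fun.
have mbox n : measurable (box n) by exact: measurable_itv.
pose f_ n := EFin \o (f \_ (box n)).
have [] // := @dominated_convergence _ _ _ mu setT measurableT f_
  (EFin \o f) (fun x => `|(f x)%:E|%E) _ _ _ _ _.
- move=> n; apply/measurable_EFinP; apply: (measurable_restrictT f (mbox n)).1.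
  exact: measurable_funTS.
- exact/measurable_EFinP.
- apply: aeW => x _ /=.
  apply: cvg_near_cst.
  have := near_box x; apply: filterS => n xn.
  by rewrite /f_/= patchE mem_set.
- exact: integrable_abse fi.
- apply: aeW => x n _ /=.
  by rewrite /f_/= patchE; case: ifPn => // _; rewrite normr0 lee_fin.
move=> _ _ h.
have {}h : (\int[mu]_x f_ n x)%E @[n --> \oo] --> (\int[mu]_x (f x)%:E)%E by [].
apply: (cvg_unique _ h) => //.
have -> : (fun n => \int[mu]_x f_ n x)%E =
    EFin \o (fun n => F n.+1%:R - F (- n.+1%:R)).
  apply/funext => n /=; rewrite -(@continuous_integral_itv f)//.
  rewrite [RHS]integral_mkcond; apply: eq_integral => x _.
  by rewrite /f_ restrict_EFin.
apply: cvg_EFin; first exact: nearW.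
apply: cvgB.
  move/cvg_pinftyP : Fb; apply.
  apply/cvgryPge => r; near=> n.
  by rewrite (@le_trans _ _ n%:R) ?ler_nat//; near: n; exact: nbhs_infty_ger.
have : F (- x) @[x --> +oo] --> a by apply/cvgNy_compNP.
move/cvg_pinftyP; apply.
apply/cvgryPge => r; near=> n.
by rewrite (@le_trans _ _ n%:R) ?ler_nat//; near: n; exact: nbhs_infty_ger.
Unshelve. all: by end_near. Qed.

(** Monotone convergence along the boxes: each partial integral is an increment of F, hence at most
    2c. *)
Lemma ge0_integrable_bounded_primitive f F c : continuous f ->
  (forall x, 0 <= f x) -> (forall x : R, is_derive x 1 F (f x)) ->
  (forall x, `|F x| <= c) -> mu.-integrable setT (EFin \o f).
Proof.
move=> cf f0 dF Fc.
have mf : measurable_fun setT f by exact: continuous_measurable_fun.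
have mbox n : measurable (box n) by exact: measurable_itv.
have nd : nondecreasing_seq box.
  move=> n m nm; apply/subsetPset => x; rewrite /box /= !in_itv /= => /andP[xl xr].
  have nm' : n.+1%:R <= m.+1%:R :> R by rewrite ler_nat ltnS.
  by rewrite (le_trans xr nm') (le_trans _ xl)// lerN2.
have U : \bigcup_n box n = setT.
  apply/seteqP; split => // x _.
  by have [N _ h] := near_box x; exists N => //; apply: h => /=.
apply/integrableP; split; first exact/measurable_EFinP.
under eq_integral do rewrite /= ger0_norm //.
have := @ge0_nondecreasing_set_cvg_integral _ (measurableTypeR R) R box
  (EFin \o f) lebesgue_measure nd mbox.
rewrite U => h.
have {}h : (\int[mu]_(x in box n) (f x)%:E)%E @[n --> \oo] -->
    (\int[mu]_x (f x)%:E)%E.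
  apply: h => [n|n x _]; last by rewrite lee_fin.
  exact/measurable_EFinP/measurable_funTS.
apply: (@le_lt_trans _ _ (c + c)%:E); last exact: ltry.
have <- := cvg_lim _ h => //.
apply: lime_le; first by apply/cvg_ex; exists (\int[mu]_x (f x)%:E)%E.
apply: nearW => n; rewrite /box (@continuous_integral_itv f F)//.
rewrite lee_fin (le_trans (ler_norm _))// (le_trans (ler_normB _ _))//.
exact: lerD.
Qed.

End RealLine.

(** * Differentiation rules in pointwise form *)

Section Calculus.
Variable R : realType.
Implicit Types (f g : R -> R) (x df dg : R).

Lemma is_derive_mul f g x df dg : is_derive x 1 f df -> is_derive x 1 g dg ->
  is_derive x 1 (fun t => f t * g t) (df * g x + f x * dg).
Proof.
move=> hf hg; apply: is_derive_eq (is_deriveM hf hg) _.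
by rewrite /GRing.scale/=; ring.
Qed.

Lemma is_derive_add f g x df dg : is_derive x 1 f df -> is_derive x 1 g dg ->
  is_derive x 1 (fun t => f t + g t) (df + dg).
Proof. exact: is_deriveD. Qed.

Lemma is_derive_sub f g x df dg : is_derive x 1 f df -> is_derive x 1 g dg ->
  is_derive x 1 (fun t => f t - g t) (df - dg).
Proof. exact: is_deriveB. Qed.

Lemma is_derive_const (c x : R) : is_derive x 1 (fun=> c) (0 : R).
Proof. exact: is_derive_cst. Qed.

Lemma is_derive_div f g x df dg : g x != 0 ->
  is_derive x 1 f df -> is_derive x 1 g dg ->
  is_derive x 1 (fun t => f t / g t) ((df * g x - f x * dg) / g x ^+ 2).
Proof.
move=> g0 hf hg; apply: is_derive_eq (is_derive_mul hf (is_deriveV g0 hg)) _.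
by rewrite /GRing.scale/=; field.
Qed.

(** The denominator is kept as g sqrt g, the shape of the curvature density, and [dg / 2] is left
    whole because the derivatives fed to it carry a factor 2. *)
Lemma is_derive_div_sqrt f g x df dg : 0 < g x ->
  is_derive x 1 f df -> is_derive x 1 g dg ->
  is_derive x 1 (fun t => f t / Num.sqrt (g t))
    ((df * g x - f x * (dg / 2)) / (g x * Num.sqrt (g x))).
Proof.
move=> g0 hf hg; have s0 : 0 < Num.sqrt (g x) by rewrite sqrtr_gt0.
have hs := is_derive1_comp (is_derive1_sqrt g0) hg.
have sN0 : Num.sqrt (g x) != 0 by rewrite gt_eqF.
have hd : is_derive x 1 (fun t => f t / Num.sqrt (g t)) _ :=
  @is_derive_div f (fun t => Num.sqrt (g t)) x df _ sN0 hf hs.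
apply: is_derive_eq hd _.
have -> : (df * g x - f x * (dg / 2)) / (g x * Num.sqrt (g x)) =
  (df * Num.sqrt (g x) ^+ 2 - f x * (dg / 2)) / (Num.sqrt (g x) ^+ 2 * Num.sqrt (g x)).
  by rewrite sqr_sqrtr // ltW.
by field.
Qed.

Lemma is_derive_continuous f (df : R -> R) :
  (forall x : R, is_derive x 1 f (df x)) -> continuous f.
Proof.
move=> hf x; apply/differentiable_continuous/derivable1_diffP.
by have := hf x.
Qed.

Lemma is_derive_expRM (a x : R) :
  is_derive x 1 (fun t => expR (a * t)) (a * expR (a * x)).
Proof.
have h : is_derive x 1 (fun t : R => a * t) a.
  apply: is_derive_eq (is_derive_mul (is_derive_const a x) (is_derive_id x 1)) _.
  by ring.
apply: is_derive_eq (is_derive1_comp (is_derive_expR (a * x)) h) _.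
by rewrite mulrC.
Qed.

Lemma measurable_fun_inv_gt0 d (T : measurableType d) (h : T -> R) :
  measurable_fun setT h -> (forall t, 0 < h t) ->
  measurable_fun setT (fun t => (h t)^-1).
Proof.
move=> mh h0; apply: (eq_measurable_fun (fun t => expR (- ln (h t)))).
  by move=> t _; rewrite expRN lnK// posrE.
apply: (@measurableT_comp _ _ _ _ _ _ (@expR R) _ (fun t => - ln (h t))).
  exact: measurable_expR.
apply: (@measurableT_comp _ _ _ _ _ _ (@GRing.opp R) _ (fun t => ln (h t))) => //.
by apply: (@measurableT_comp _ _ _ _ _ _ (@ln R) _ h).
Qed.

End Calculus.

(** * An integrable profile with exponential decay *)

Section Bell.
Variables (R : realType) (b : R).
Hypothesis b_gt0 : 0 < b.

(* Comparable to exp (- 2 b |t|), but smooth and with an explicit primitive. *)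
Definition bell (t : R) : R := (expR (b * t) + expR (- b * t)) ^- 2.

Lemma bell_denom_gt1 t : 1 < expR (b * t) + expR (- b * t).
Proof.
case: (leP 0 (b * t)) => bt.
  rewrite -[ltLHS]addr0 ler_ltD ?expR_gt0//.
  by rewrite -expR0 ler_expR.
rewrite -[ltLHS]add0r ltr_leD ?expR_gt0//.
by rewrite -expR0 ler_expR mulNr oppr_ge0 ltW.
Qed.

Lemma bell_gt0 t : 0 < bell t.
Proof. by rewrite invr_gt0 exprn_gt0// (lt_trans ltr01) ?bell_denom_gt1. Qed.

Lemma bell_le1 t : bell t <= 1.
Proof.
by rewrite invf_le1 ?exprn_gt0// ?expr_ge1 ?ltW// ?(lt_trans ltr01) ?bell_denom_gt1.
Qed.

(** As [bell b] is sech(bt)^2 / 4, tanh(bt) / (4b) is a primitive; adding the constant 1 / (4b)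
    gives this quotient of exponentials, with values in [0, 1 / (2b)]. *)
Lemma is_derive_bell_primitive (t : R) :
  is_derive t 1 (fun t => (2 * b)^-1 *
     (expR (b * t) / (expR (b * t) + expR (- b * t)))) (bell t).
Proof.
have S0 : expR (b * t) + expR (- b * t) != 0.
  by rewrite gt_eqF// (lt_trans ltr01) ?bell_denom_gt1.
have h := is_derive_mul (is_derive_const (2 * b)^-1 t)
  (@is_derive_div R _ (fun t => expR (b * t) + expR (- b * t)) t _ _ S0
    (is_derive_expRM b t)
    (is_derive_add (is_derive_expRM b t) (is_derive_expRM (- b) t))).
apply: is_derive_eq h _.
have e1 : expR (b * t) * expR (- b * t) = 1 by rewrite mulNr expRxMexpNx_1.
rewrite /bell mul0r add0r.
have -> : b * expR (b * t) * (expR (b * t) + expR (- b * t)) -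
  expR (b * t) * (b * expR (b * t) + - b * expR (- b * t)) = 2 * b.
  transitivity (2 * b * (expR (b * t) * expR (- b * t))); first by ring.
  by rewrite e1 mulr1.
rewrite mulrA mulVf ?mul1r//.
by rewrite mulf_neq0// gt_eqF.
Qed.

Lemma continuous_bell : continuous bell.
Proof.
have S0 t : (expR (b * t) + expR (- b * t)) ^+ 2 != 0.
  by rewrite expf_neq0// gt_eqF// (lt_trans ltr01) ?bell_denom_gt1.
have h t := is_derive_add (is_derive_expRM b t) (is_derive_expRM (- b) t).
move=> t; apply: cvgV => //.
have /= := is_derive_continuous (fun t => is_deriveX 2 (h t)); exact.
Qed.

Lemma integrable_bell : (@lebesgue_measure R).-integrable setT (EFin \o bell).
Proof.
apply: (ge0_integrable_bounded_primitive (c := (2 * b)^-1) continuous_bell _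
  is_derive_bell_primitive).
  by move=> x; rewrite ltW ?bell_gt0.
move=> t; have S0 := lt_trans ltr01 (bell_denom_gt1 t).
have i0 : 0 <= (2 * b)^-1 by rewrite invr_ge0 mulr_ge0// ltW.
rewrite ger0_norm; last first.
  by rewrite mulr_ge0// divr_ge0 ?expR_ge0// ltW.
rewrite ler_piMr// ler_pdivrMr// mul1r lerDl expR_ge0 //.
Qed.

Lemma cvgy_bell : bell x @[x --> +oo] --> (0 : R).
Proof.
apply: (squeeze_cvgr (f := fun=> 0) (h := fun t => expR (- (b * t)))).
- near=> t; rewrite ltW ?bell_gt0//=.
  have S1 := bell_denom_gt1 t; have S0 := lt_trans ltr01 S1.
  rewrite expRN /bell lef_pV2 ?posrE ?exprn_gt0 ?expR_gt0//.
  apply: (@le_trans _ _ (expR (b * t) + expR (- b * t))).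
    by rewrite lerDl expR_ge0.
  by rewrite expr2 ler_peMl ?ltW.
- exact: cvg_cst.
- apply: (cvg_comp _ _ _ (@cvgr_expR R)).
  apply/cvgryPge => r; near=> t.
  rewrite -ler_pdivrMl//; near: t; exact: nbhs_pinfty_ge.
Unshelve. all: by end_near. Qed.

Lemma cvgNy_bell : bell x @[x --> -oo] --> (0 : R).
Proof.
apply/cvgNy_compNP; rewrite (_ : bell \o _ = bell); first exact: cvgy_bell.
by apply/funext => t; rewrite /bell /= !mulNr !mulrN opprK addrC.
Qed.

End Bell.

(** * Gram data and the curvature density *)

(* The inner products of sigma, sigma' and sigma'' that the metric and its
   curvature involve: [gij t] stands for (sigma^(i) t, sigma^(j) t). *)
Record gram (R : realType) :=
  Gram { g00 : R -> R; g01 : R -> R; g11 : R -> R; g02 : R -> R; g12 : R -> R }.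

Section Gram.
Variable R : realType.
Implicit Types (X Y : gram R) (t u v : R).

Definition gram_area X t := g00 X t * g11 X t - g01 X t ^+ 2.

Definition gram_turn X t := g02 X t * g11 X t - g01 X t * g12 X t.

Definition theta_density X t :=
  gram_turn X t / (g11 X t * Num.sqrt (gram_area X t)).

(** The speed of sigma / |sigma| on the unit sphere. *)
Definition rotation_density X t := Num.sqrt (gram_area X t) / g00 X t.

Definition gram_det X Y u v :=
  g00 X u * g11 X u * (g00 Y v * g11 Y v) - g01 X u ^+ 2 * g01 Y v ^+ 2.

(* The derivative in v of g01 Y v / sqrt (gram_det X Y u v), which is, up to the
   factor g01 X u, the cotangent of the angle between the coordinate curves. *)
Definition cot_deriv X Y u v :=
  g00 X u * g11 X u
  * (g11 Y v * gram_area Y v + g00 Y v * gram_turn Y v)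
  / (gram_det X Y u v * Num.sqrt (gram_det X Y u v)).

Definition curvature_density X Y u v :=
  (g00 X u * gram_turn X u * (g00 Y v * gram_turn Y v)
   - g11 X u * gram_area X u * (g11 Y v * gram_area Y v))
  / (gram_det X Y u v * Num.sqrt (gram_det X Y u v)).

(** All that the analysis uses of a curve. The quotient of [gram_area] by [g00 * g11] is the squared
    sine of the angle between sigma and sigma', so [tame_area_le] bounds that sine by
    [c * bell ^ 2]; the signs of [g01] then send the angle to 0 at +oo and to pi at -oo. Continuity
    of [g02] and [g12] suffices, since the curvature involves no derivative of them. *)
Record tame X (b c : R) : Prop := Tame {
  tame_b : 0 < b;
  tame_c : 0 <= c;
  tame_d00 : forall t : R, is_derive t 1 (g00 X) (2 * g01 X t);
  tame_d01 : forall t : R, is_derive t 1 (g01 X) (g11 X t + g02 X t);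
  tame_d11 : forall t : R, is_derive t 1 (g11 X) (2 * g12 X t);
  tame_c02 : continuous (g02 X);
  tame_c12 : continuous (g12 X);
  tame_00_gt0 : forall t, 0 < g00 X t;
  tame_area_gt0 : forall t, 0 < gram_area X t;
  tame_00_le : forall t, g00 X t <= c ^+ 2 * g11 X t;
  tame_11_le : forall t, g11 X t <= c ^+ 2 * g00 X t;
  tame_turn_le : forall t, `|gram_turn X t| <= c * gram_area X t;
  tame_area_le : forall t,
    gram_area X t <= (c * bell b t ^+ 2) ^+ 2 * (g00 X t * g11 X t);
  tame_01_pos : \forall t \near +oo, 0 < g01 X t;
  tame_01_neg : \forall t \near -oo, g01 X t < 0 }.

(** For tame data both summands are nonnegative, which the subtraction in [gram_det] hides. Dropping
    the second one, here or after [gram_detC], gives the two lower bounds on the determinant. *)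
Lemma gram_det_areaE X Y u v : gram_det X Y u v =
  gram_area X u * (g00 Y v * g11 Y v) + g01 X u ^+ 2 * gram_area Y v.
Proof. by rewrite /gram_det /gram_area; ring. Qed.

Lemma gram_detC X Y u v : gram_det X Y u v = gram_det Y X v u.
Proof. by rewrite /gram_det; ring. Qed.

Lemma curvature_density_split X Y u v : g00 Y v != 0 -> g11 X u != 0 ->
  curvature_density X Y u v =
    gram_turn X u / g11 X u * cot_deriv X Y u v
    - gram_area Y v / g00 Y v * cot_deriv Y X v u.
Proof.
move=> D0 B0; rewrite /curvature_density /cot_deriv (gram_detC Y X).
(* The common factor G^(-3/2) is frozen as an atom, so that [field] has only D and B to clear. *)
set S := (gram_det _ _ _ _ * _); rewrite -[S^-1](mulr1).
set i := S^-1.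
by field; rewrite D0 B0.
Qed.

Section Tame.
Variables (X : gram R) (b c : R).
Hypothesis tX : tame X b c.

Lemma tame_11_gt0 t : 0 < g11 X t.
Proof.
have := tame_area_gt0 tX t; rewrite /gram_area subr_gt0 => h.
by rewrite -(pmulr_rgt0 _ (tame_00_gt0 tX t)) (le_lt_trans _ h)// sqr_ge0.
Qed.

Lemma tame_prod_gt0 t : 0 < g00 X t * g11 X t.
Proof. by rewrite mulr_gt0 ?tame_11_gt0 ?(tame_00_gt0 tX). Qed.

Lemma tame_c00 : continuous (g00 X).
Proof. exact: is_derive_continuous (tame_d00 tX). Qed.

Lemma tame_c01 : continuous (g01 X).
Proof. exact: is_derive_continuous (tame_d01 tX). Qed.

Lemma tame_c11 : continuous (g11 X).
Proof. exact: is_derive_continuous (tame_d11 tX). Qed.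

Lemma is_derive_gram_area t : is_derive t 1 (gram_area X)
  (2 * (g00 X t * g12 X t - g01 X t * g02 X t)).
Proof.
have h := is_derive_sub (is_derive_mul (tame_d00 tX t) (tame_d11 tX t))
  (is_derive_mul (tame_d01 tX t) (tame_d01 tX t)).
by apply: is_derive_eq h _; ring.
Qed.

Lemma continuous_gram_area : continuous (gram_area X).
Proof. exact: is_derive_continuous is_derive_gram_area. Qed.

Lemma continuous_gram_turn : continuous (gram_turn X).
Proof.
move=> t; apply: cvgB; apply: cvgM.
- exact: (tame_c02 tX).
- exact: tame_c11.
- exact: tame_c01.
- exact: (tame_c12 tX).
Qed.

Lemma continuous_sqrt_area : continuous (fun t => Num.sqrt (gram_area X t)).
Proof.
move=> t; apply: (@continuous_comp _ _ _ (gram_area X) Num.sqrt).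
  exact: continuous_gram_area.
exact: sqrt_continuous.
Qed.

Lemma continuous_theta_density : continuous (theta_density X).
Proof.
move=> t; apply: cvgM; first exact: continuous_gram_turn.
apply: cvgV.
  by rewrite mulf_neq0// gt_eqF ?tame_11_gt0// sqrtr_gt0 (tame_area_gt0 tX).
by apply: cvgM; [exact: tame_c11|exact: continuous_sqrt_area].
Qed.

Lemma continuous_rotation_density : continuous (rotation_density X).
Proof.
move=> t; apply: cvgM; first exact: continuous_sqrt_area.
by apply: cvgV; [rewrite gt_eqF// (tame_00_gt0 tX)|exact: tame_c00].
Qed.

Lemma sqrt_prod_le_g00 t : Num.sqrt (g00 X t * g11 X t) <= c * g00 X t.
Proof.
have A0 := ltW (tame_00_gt0 tX t); have c0 := tame_c tX.
rewrite -[leRHS]ger0_norm ?mulr_ge0// -sqrtr_sqr ler_wsqrtr//.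
by rewrite exprMn mulrC [X in _ <= _ * X]expr2 mulrA ler_wpM2r// (tame_11_le tX).
Qed.

Lemma sqrt_prod_le_g11 t : Num.sqrt (g00 X t * g11 X t) <= c * g11 X t.
Proof.
have B0 := ltW (tame_11_gt0 t); have c0 := tame_c tX.
rewrite -[leRHS]ger0_norm ?mulr_ge0// -sqrtr_sqr ler_wsqrtr//.
by rewrite exprMn [X in _ <= _ * X]expr2 mulrA ler_wpM2r// (tame_00_le tX).
Qed.

Lemma sqrt_area_le t : Num.sqrt (gram_area X t) <=
  c * bell b t ^+ 2 * Num.sqrt (g00 X t * g11 X t).
Proof.
have c0 := tame_c tX.
have e0 : 0 <= c * bell b t ^+ 2 by rewrite mulr_ge0// sqr_ge0.
rewrite -[X in X * Num.sqrt _](ger0_norm e0).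
by rewrite -sqrtr_sqr -sqrtrM ?sqr_ge0// ler_wsqrtr// (tame_area_le tX).
Qed.

(** The density is the sine of the angle between sigma and sigma', at most [c * bell ^ 2], times
    |sigma'| / |sigma|, at most c. *)
Lemma rotation_density_le t : rotation_density X t <= c ^+ 2 * bell b t ^+ 2.
Proof.
have c0 := tame_c tX; have b0 := tame_b tX.
rewrite /rotation_density ler_pdivrMr ?(tame_00_gt0 tX)//.
apply: le_trans (sqrt_area_le t) _.
move: (bell b t ^+ 2) (sqr_ge0 (bell b t)) => e e0.
rewrite [c ^+ 2]expr2 -!mulrA; apply: ler_wpM2l => //.
rewrite [leRHS]mulrCA; apply: ler_wpM2l => //.
exact: sqrt_prod_le_g00.
Qed.

Lemma rotation_density_ge0 t : 0 <= rotation_density X t.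
Proof. by rewrite divr_ge0 ?sqrtr_ge0// ltW// (tame_00_gt0 tX). Qed.

(** By |T| <= c W one square root of W cancels; what remains is c times the sine of the angle times
    |sigma| / |sigma'|. *)
Lemma theta_density_le t : `|theta_density X t| <= c ^+ 3 * bell b t ^+ 2.
Proof.
have c0 := tame_c tX; have W0 := tame_area_gt0 tX t; have B0 := tame_11_gt0 t.
have sW0 : 0 < Num.sqrt (gram_area X t) by rewrite sqrtr_gt0.
rewrite normrM normfV [X in _ / X]gtr0_norm ?mulr_gt0//.
rewrite ler_pdivrMr ?mulr_gt0//.
apply: le_trans (tame_turn_le tX t) _.
have : Num.sqrt (gram_area X t) <= c ^+ 2 * bell b t ^+ 2 * g11 X t.
  apply: le_trans (sqrt_area_le t) _.
  move: (bell b t ^+ 2) (sqr_ge0 (bell b t)) => e e0.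
  rewrite [c ^+ 2]expr2 -!mulrA; apply: ler_wpM2l => //.
  rewrite [leRHS]mulrCA; apply: ler_wpM2l => //.
  exact: sqrt_prod_le_g11.
move=> h0; rewrite -{1}(sqr_sqrtr (ltW W0)); move: h0.
move: (bell b t ^+ 2) (Num.sqrt (gram_area X t)) sW0 => e w w0 h.
have -> : c ^+ 3 * e * (g11 X t * w) = c * w * (c ^+ 2 * e * g11 X t) by ring.
rewrite expr2 [leLHS]mulrA; apply: ler_wpM2l => //.
by rewrite mulr_ge0// ltW.
Qed.

Lemma bell_sqr_le t : bell b t ^+ 2 <= bell b t.
Proof.
have b0 := tame_b tX.
by rewrite expr2 ler_piMr ?bell_le1// ltW// bell_gt0.
Qed.

Lemma integrable_le_bell (f : R -> R) (K : R) : continuous f -> 0 <= K ->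
  (forall t, `|f t| <= K * bell b t) ->
  (@lebesgue_measure R).-integrable setT (EFin \o f).
Proof.
move=> cf K0 fK; have b0 := tame_b tX.
have h := integrableZl measurableT K (integrable_bell b0).
apply: (le_integrable measurableT _ _ h).
- by apply/measurable_EFinP; exact: continuous_measurable_fun.
- move=> t _ /=; rewrite lee_fin [leRHS]ger0_norm ?fK//.
  by rewrite mulr_ge0// ltW// bell_gt0.
Qed.

Lemma integrable_theta_density :
  (@lebesgue_measure R).-integrable setT (EFin \o theta_density X).
Proof.
have c0 := tame_c tX.
apply: (integrable_le_bell continuous_theta_density (K := c ^+ 3)).
  by rewrite exprn_ge0.
move=> t; apply: le_trans (theta_density_le t) _.
by rewrite ler_wpM2l ?exprn_ge0// bell_sqr_le.
Qed.

Lemma integrable_rotation_density :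
  (@lebesgue_measure R).-integrable setT (EFin \o rotation_density X).
Proof.
have c0 := tame_c tX.
apply: (integrable_le_bell continuous_rotation_density (K := c ^+ 2)).
  by rewrite exprn_ge0.
move=> t; rewrite ger0_norm ?rotation_density_ge0//.
apply: le_trans (rotation_density_le t) _.
by rewrite ler_wpM2l ?exprn_ge0// bell_sqr_le.
Qed.

(** The angle is the one between sigma and sigma'. Where [g01] vanishes the value is 0 by the
    convention on division, so uses are confined to points where it does not. *)
Definition sqr_tan t := gram_area X t / g01 X t ^+ 2.

(** The squared sine tends to 0; once it is below 1/2 the squared cosine exceeds 1/2, and the
    squared tangent is at most twice the squared sine. *)
Lemma cvg_sqr_tan (F : set_system R) (FF : Filter F) :
  bell b x @[x --> F] --> 0 -> sqr_tan x @[x --> F] --> 0.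
Proof.
move=> bF; have c0 := tame_c tX.
have eF : (c * bell b x ^+ 2) ^+ 2 @[x --> F] --> 0.
  have -> : (0 : R) = (c * (0 * 0)) * (c * (0 * 0)) by rewrite !mulr0.
  by apply: cvgM; (apply: cvgM; [exact: cvg_cst|exact: cvgM]).
have eF2 : 2 * (c * bell b x ^+ 2) ^+ 2 @[x --> F] --> 0.
  rewrite -(mulr0 2); apply: cvgM => //; exact: cvg_cst.
apply: (squeeze_cvgr (f := fun=> 0) _ (cvg_cst 0) eF2).
have half_gt0 : 0 < 2^-1 :> R by rewrite invr_gt0.
move/cvgr_dist_lt : eF => /(_ _ half_gt0); apply: filterS => t /=.
rewrite sub0r normrN ger0_norm ?sqr_ge0// => e2.
have W0 := tame_area_gt0 tX t; have AB0 := tame_prod_gt0 t.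
have C2E : g01 X t ^+ 2 = g00 X t * g11 X t - gram_area X t.
  by rewrite /gram_area opprB addrC subrK.
have hW := tame_area_le tX t.
have C2 : 2^-1 * (g00 X t * g11 X t) <= g01 X t ^+ 2.
  rewrite C2E; set e := (c * _) ^+ 2 in e2 hW.
  have : e * (g00 X t * g11 X t) <= 2^-1 * (g00 X t * g11 X t).
    by rewrite ler_wpM2r ?ltW.
  by move=> h3; have := le_trans hW h3; lra.
rewrite /sqr_tan; apply/andP; split.
  by apply: divr_ge0; [exact: ltW|exact: sqr_ge0].
rewrite ler_pdivrMr; last first.
  by rewrite (lt_le_trans _ C2)// mulr_gt0.
apply: le_trans hW _; rewrite [leRHS]mulrAC [leRHS]mulrC.
by apply: ler_wpM2l; [exact: sqr_ge0|lra].
Qed.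

End Tame.

End Gram.

(** * Limits and one-variable bounds for a pair of curves *)

Section TwoGrams.
Variables (R : realType) (X Y : gram R) (b c b' c' : R).
Hypotheses (tX : tame X b c) (tY : tame Y b' c').
Implicit Types (u v : R).
Notation mu := (@lebesgue_measure R).

(** Pulling out [g01 Y v ^+ 2] exhibits the limit of F / sqrt G: what stays under the root tends to
    W. *)
Lemma gram_det_tanE u v : g01 Y v != 0 -> gram_det X Y u v =
  g01 Y v ^+ 2 * (gram_area X u + g00 X u * g11 X u * sqr_tan Y v).
Proof. by move=> F0; rewrite /gram_det /sqr_tan /gram_area; field. Qed.

Lemma gram_det_ge_l u v :
  gram_area X u * (g00 Y v * g11 Y v) <= gram_det X Y u v.
Proof.
rewrite gram_det_areaE lerDl mulr_ge0 ?sqr_ge0//.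
exact: ltW (tame_area_gt0 tY v).
Qed.

Lemma gram_det_gt0 u v : 0 < gram_det X Y u v.
Proof.
apply: lt_le_trans (gram_det_ge_l u v).
by rewrite mulr_gt0 ?(tame_area_gt0 tX) ?(tame_prod_gt0 tY).
Qed.

Lemma is_derive_gram_det u v : is_derive v 1 (gram_det X Y u)
  (2 * (g00 X u * g11 X u * (g01 Y v * g11 Y v + g00 Y v * g12 Y v)
        - g01 X u ^+ 2 * g01 Y v * (g11 Y v + g02 Y v))).
Proof.
have h := is_derive_sub
  (is_derive_mul (is_derive_const (g00 X u * g11 X u) v)
     (is_derive_mul (tame_d00 tY v) (tame_d11 tY v)))
  (is_derive_mul (is_derive_const (g01 X u ^+ 2) v)
     (is_derive_mul (tame_d01 tY v) (tame_d01 tY v))).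
by apply: is_derive_eq h _; ring.
Qed.

(** In the numerator F' G - F G' / 2 the terms in [g01 X u ^+ 2] cancel, which leaves A B times a
    function of v alone. *)
Lemma is_derive_cot u v : is_derive v 1
  (fun v => g01 Y v / Num.sqrt (gram_det X Y u v)) (cot_deriv X Y u v).
Proof.
have h := is_derive_div_sqrt (gram_det_gt0 u v) (tame_d01 tY v)
  (is_derive_gram_det u v).
apply: is_derive_eq h _; rewrite /cot_deriv; congr (_ / _).
by rewrite /gram_det /gram_area /gram_turn; field.
Qed.

Lemma continuous_cot_deriv u : continuous (cot_deriv X Y u).
Proof.
have cG : continuous (gram_det X Y u) := is_derive_continuous (is_derive_gram_det u).
have csG : continuous (fun v => Num.sqrt (gram_det X Y u v)).
  move=> v; apply: (@continuous_comp _ _ _ (gram_det X Y u) Num.sqrt).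
    exact: cG.
  exact: sqrt_continuous.
move=> v; apply: cvgM; last first.
  apply: cvgV; last by apply: cvgM; [exact: cG|exact: csG].
  by rewrite mulf_neq0// gt_eqF ?sqrtr_gt0// gram_det_gt0.
apply: cvgM; first exact: cvg_cst.
apply: cvgD; apply: cvgM.
- exact: (tame_c11 tY).
- exact: (continuous_gram_area tY).
- exact: (tame_c00 tY).
- exact: (continuous_gram_turn tY).
Qed.

Lemma cvg_inv_sqrt_det (F : set_system R) (FF : ProperFilter F) u :
  bell b' x @[x --> F] --> 0 ->
  (Num.sqrt (gram_area X u + g00 X u * g11 X u * sqr_tan Y v))^-1
    @[v --> F] --> (Num.sqrt (gram_area X u))^-1.
Proof.
move=> bF; apply: cvgV; first by rewrite gt_eqF// sqrtr_gt0 (tame_area_gt0 tX).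
apply: continuous_cvg; first exact: sqrt_continuous.
rewrite -[X in _ --> X]addr0; apply: cvgD; first exact: cvg_cst.
rewrite -(mulr0 (g00 X u * g11 X u)); apply: cvgM; first exact: cvg_cst.
exact: (cvg_sqr_tan tY).
Qed.

(** The root of F^2 is |F|, so the sign of F decides the sign of the limit; this case serves the end
    +oo, [cvg_cot_neg] the end -oo. *)
Lemma cvg_cot_pos (F : set_system R) (FF : ProperFilter F) u :
  bell b' x @[x --> F] --> 0 -> (\forall v \near F, 0 < g01 Y v) ->
  g01 Y v / Num.sqrt (gram_det X Y u v) @[v --> F]
    --> (Num.sqrt (gram_area X u))^-1.
Proof.
move=> bF Fpos; apply: (cvg_trans _ (cvg_inv_sqrt_det (u := u) FF bF)).
apply: near_eq_cvg; apply: filterS Fpos => v F0.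
rewrite gram_det_tanE ?gt_eqF// sqrtrM ?sqr_ge0// sqrtr_sqr gtr0_norm//.
by rewrite invfM mulVKf ?gt_eqF//.
Qed.

Lemma cvg_cot_neg (F : set_system R) (FF : ProperFilter F) u :
  bell b' x @[x --> F] --> 0 -> (\forall v \near F, g01 Y v < 0) ->
  g01 Y v / Num.sqrt (gram_det X Y u v) @[v --> F]
    --> - (Num.sqrt (gram_area X u))^-1.
Proof.
move=> bF Fneg; apply: (cvg_trans _ (cvgN (cvg_inv_sqrt_det (u := u) FF bF))).
apply: near_eq_cvg; apply: filterS Fneg => v F0 /=.
rewrite gram_det_tanE ?lt_eqF// sqrtrM ?sqr_ge0// sqrtr_sqr ltr0_norm//.
by rewrite invfM invrN mulNr mulrN mulVKf ?lt_eqF//.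
Qed.

(** The two lower bounds are spent unequally: W DE on the factor G, and AB W' under the root.
    Dividing [curvature_bound] by this product removes W and leaves sqrt W', hence decay in v. *)
Lemma sqr_gram_det_ge u v :
  gram_area X u * (g00 Y v * g11 Y v)
    * (Num.sqrt (g00 X u * g11 X u) * Num.sqrt (gram_area Y v))
  <= gram_det X Y u v * Num.sqrt (gram_det X Y u v).
Proof.
have W0 := ltW (tame_area_gt0 tX u); have W0' := ltW (tame_area_gt0 tY v).
have AB0 := ltW (tame_prod_gt0 tX u); have DE0 := ltW (tame_prod_gt0 tY v).
apply: ler_pM; [exact: mulr_ge0| |exact: gram_det_ge_l|].
  by rewrite mulr_ge0 ?sqrtr_ge0.
rewrite -sqrtrM// ler_wsqrtr// gram_detC gram_det_areaE mulrC lerDl.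
by rewrite mulr_ge0 ?sqr_ge0.
Qed.


(* Both pieces of the curvature density are dominated by this quantity, and
   [gram_det >= A1 B1 W2] and [gram_det >= W1 A2 B2] bound it in two ways. *)
Definition curvature_bound u v :=
  g11 X u * g11 Y v * gram_area X u * gram_area Y v
  / (gram_det X Y u v * Num.sqrt (gram_det X Y u v)).

(** What survives the cancellation is B / sqrt (A B) = |s1'| / |s1| <= c times the rotation density
    of the second curve. The decay is in v only; the exchanged roles supply the decay in u. *)
Lemma curvature_bound_le u v :
  curvature_bound u v <= c * (c' ^+ 2 * bell b' v ^+ 2).
Proof.
have W0 := tame_area_gt0 tX u; have W0' := tame_area_gt0 tY v.
have A0 := tame_00_gt0 tX u; have B0 := tame_11_gt0 tX u.
have D0 := tame_00_gt0 tY v; have E0 := tame_11_gt0 tY v.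
have sW0' : 0 < Num.sqrt (gram_area Y v) by rewrite sqrtr_gt0.
have sAB0 : 0 < Num.sqrt (g00 X u * g11 X u) by rewrite sqrtr_gt0 mulr_gt0.
have c0 := tame_c tX; have c0' := tame_c tY.
have hB : g11 X u / Num.sqrt (g00 X u * g11 X u) <= c.
  rewrite ler_pdivrMr//.
  have : g11 X u ^+ 2 <= (c * Num.sqrt (g00 X u * g11 X u)) ^+ 2.
    rewrite exprMn (sqr_sqrtr (ltW (tame_prod_gt0 tX u))) mulrA [leLHS]expr2.
    by apply: ler_wpM2r; [exact: ltW|exact: (tame_11_le tX)].
  have r0 : 0 <= c * Num.sqrt (g00 X u * g11 X u) by rewrite mulr_ge0 ?sqrtr_ge0.
  by move=> h; rewrite -(ler_pXn2r (n := 2))// nnegrE ltW.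
apply: (@le_trans _ _ (g11 X u / Num.sqrt (g00 X u * g11 X u)
                       * rotation_density Y v)).
  rewrite /curvature_bound ler_pdivrMr; last first.
    by rewrite mulr_gt0 ?sqrtr_gt0 ?gram_det_gt0.
  have hG := sqr_gram_det_ge u v.
  set K := _ / _ * rotation_density Y v.
  have K0 : 0 <= K.
    rewrite mulr_ge0 ?(rotation_density_ge0 tY)// divr_ge0 ?sqrtr_ge0//.
    exact: ltW.
  apply: le_trans (ler_wpM2l K0 hG).
  rewrite le_eqVlt; apply/orP; left; apply/eqP.
  rewrite /K /rotation_density.
  have := sqr_sqrtr (ltW W0').
  move: (Num.sqrt (gram_area Y v)) sW0' => w w0 <-.
  by field; rewrite !gt_eqF.
apply: ler_pM => //; first by rewrite divr_ge0 ?sqrtr_ge0// ltW.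
  exact: (rotation_density_ge0 tY).
exact: (rotation_density_le tY).
Qed.

End TwoGrams.

(** * The angle identity of one curve and domination over the plane *)

Section GaussBonnet.
Variable R : realType.
Notation mu := (@lebesgue_measure R).
Implicit Types (X Y : gram R) (b c u v : R).

(** The cotangent is the inverse of a positive tangent that tends to 0. Fixing g only up to sign
    lets one statement serve [g01] at +oo and [- g01] at -oo. *)
Lemma cvgy_cot_pos X b c (g : R -> R) (F : set_system R) (FF : ProperFilter F) :
  tame X b c -> (forall t, g t ^+ 2 = g01 X t ^+ 2) ->
  bell b x @[x --> F] --> 0 -> (\forall t \near F, 0 < g t) ->
  g t / Num.sqrt (gram_area X t) @[t --> F] --> +oo.
Proof.
move=> tX gE bF g0; apply/gtr0_cvgV0.
  apply: filterS g0 => t g0.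
  by rewrite divr_gt0 ?sqrtr_gt0// (tame_area_gt0 tX).
have h : Num.sqrt (sqr_tan X t) @[t --> F] --> 0.
  rewrite -(@sqrtr0 R); apply: continuous_cvg; first exact: sqrt_continuous.
  exact: (cvg_sqr_tan tX).
apply: (cvg_trans _ h); apply: near_eq_cvg; apply: filterS g0 => t g0 /=.
rewrite /sqr_tan -gE sqrtrM; last by rewrite ltW// (tame_area_gt0 tX).
by rewrite sqrtrV ?sqr_ge0// sqrtr_sqr gtr0_norm// invf_div.
Qed.

Lemma integral_rotation_theta X b c : tame X b c ->
  (\int[mu]_t (rotation_density X t + theta_density X t)%:E = pi%:E)%E.
Proof.
move=> tX; have b0 := tame_b tX.
have -> : pi = pi / 2 - - (pi / 2) :> R by rewrite opprK -splitr.
apply: (@integral_setT_FTC _ _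
  (fun t => atan (g01 X t / Num.sqrt (gram_area X t)))).
- move=> t; apply: cvgD.
    exact: (continuous_rotation_density tX).
  exact: (continuous_theta_density tX).
- apply: (@integrableD _ _ _ mu _ measurableT (EFin \o rotation_density X)
    (EFin \o theta_density X)).
    exact: integrable_rotation_density tX.
  exact: integrable_theta_density tX.
- move=> t; have W0 := tame_area_gt0 tX t.
  have A0 := tame_00_gt0 tX t; have B0 := tame_11_gt0 tX t.
  have h := is_derive1_comp (is_derive1_atan _)
    (is_derive_div_sqrt W0 (tame_d01 tX t) (is_derive_gram_area tX t)).
  apply: is_derive_eq h _.
  rewrite /rotation_density /theta_density.
  have C2 : g01 X t ^+ 2 = g00 X t * g11 X t - gram_area X t.
    by rewrite /gram_area opprB addrC subrK.
  (* Naming the root w, with W = w^2, makes the derivative rational in w. *)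
  have [w w0 [wE WE]] : exists2 w, 0 < w &
      Num.sqrt (gram_area X t) = w /\ gram_area X t = w ^+ 2.
    exists (Num.sqrt (gram_area X t)); first by rewrite sqrtr_gt0.
    by rewrite sqr_sqrtr// ltW.
  rewrite WE in C2; rewrite wE WE expr_div_n C2 /gram_turn.
  have -> : 1 + (g00 X t * g11 X t - w ^+ 2) / w ^+ 2 = g00 X t * g11 X t / w ^+ 2.
    by field; rewrite gt_eqF.
  (* The numerator is regrouped as B W + A T plus a multiple of C^2 - (A B - W), which is zero. *)
  have -> : (g11 X t + g02 X t) * w ^+ 2 -
     g01 X t * (2 * (g00 X t * g12 X t - g01 X t * g02 X t) / 2) =
     g11 X t * w ^+ 2 + g00 X t * (g02 X t * g11 X t - g01 X t * g12 X t)
     + g02 X t * (g01 X t ^+ 2 - (g00 X t * g11 X t - w ^+ 2)) by field.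
  rewrite C2 subrr mulr0 addr0.
  by field; rewrite !gt_eqF.
- have neg : \forall t \near -oo, 0 < - g01 X t.
    by apply: filterS (tame_01_neg tX) => t; rewrite oppr_gt0.
  have h := cvgy_cot_pos _ tX (fun t => sqrrN (g01 X t)) (cvgNy_bell b0) neg.
  have h2 : - atan (- g01 X t / Num.sqrt (gram_area X t)) @[t --> -oo] --> - (pi / 2).
    by apply: cvgN; exact: (cvg_comp _ _ (h _) (@cvgy_atan R)).
  move: h2; apply: cvg_trans.
  by apply: near_eq_cvg; apply: nearW => t /=; rewrite mulNr atanN opprK.
- have h := cvgy_cot_pos _ tX (fun=> erefl) (cvgy_bell b0) (tame_01_pos tX).
  exact: (cvg_comp _ _ (h _) (@cvgy_atan R)).
Qed.

Lemma curvature_boundC X Y u v : curvature_bound X Y u v = curvature_bound Y X v u.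
Proof.
rewrite /curvature_bound (gram_detC X Y).
by congr (_ / _); ring.
Qed.

Section Pair.
Variables (X Y : gram R) (b c b' c' : R).
Hypotheses (tX : tame X b c) (tY : tame Y b' c').

Lemma curvature_bound_ge0 u v : 0 <= curvature_bound X Y u v.
Proof.
have h1 := ltW (tame_11_gt0 tX u); have h2 := ltW (tame_11_gt0 tY v).
have h3 := ltW (tame_area_gt0 tX u); have h4 := ltW (tame_area_gt0 tY v).
have h5 := ltW (gram_det_gt0 tX tY u v).
by rewrite divr_ge0 ?mulr_ge0 ?sqrtr_ge0.
Qed.

(** The geometric mean of the two one-variable bounds: their product is [(c * c') ^+ 3] times the
    square of [bell b u * bell b' v]. *)
Lemma curvature_bound_le_bell u v :
  curvature_bound X Y u v <= (1 + (c * c') ^+ 3) * (bell b u * bell b' v).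
Proof.
have N0 := curvature_bound_ge0 u v.
have c0 := tame_c tX; have c0' := tame_c tY.
have b0 := ltW (bell_gt0 b u); have b0' := ltW (bell_gt0 b' v).
have h1 := curvature_bound_le tX tY u v.
have h2 := curvature_bound_le tY tX v u; rewrite -curvature_boundC in h2.
have z0 : 0 <= (c * c') ^+ 3 by rewrite exprn_ge0 ?mulr_ge0.
have K0 : 0 <= (1 + (c * c') ^+ 3) * (bell b u * bell b' v).
  by apply: mulr_ge0; [exact: addr_ge0|exact: mulr_ge0].
rewrite -(ler_pXn2r (n := 2))// [leLHS]expr2; apply: (le_trans (ler_pM N0 N0 h1 h2)).
have -> : c * (c' ^+ 2 * bell b' v ^+ 2) * (c' * (c ^+ 2 * bell b u ^+ 2)) =
  (c * c') ^+ 3 * (bell b u * bell b' v) ^+ 2 by ring.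
rewrite [leRHS]exprMn; apply: ler_wpM2r; first exact: sqr_ge0.
(* The constant [1 + z] replaces the square root of z, since z <= (1 + z)^2. *)
by move: ((c * c') ^+ 3) z0 => z z0; nra.
Qed.

(** From D <= c'^2 E and |T'| <= c' W', the term D T' is at most c'^3 E W'. The factor A / W,
    possibly unbounded in u, is absorbed later by the coefficient of the flux. *)
Lemma cot_deriv_le u v : `|cot_deriv X Y u v| <=
  (1 + c' ^+ 3) * (g00 X u / gram_area X u) * curvature_bound X Y u v.
Proof.
have A0 := tame_00_gt0 tX u; have B0 := tame_11_gt0 tX u.
have D0 := tame_00_gt0 tY v; have E0 := tame_11_gt0 tY v.
have W0 := tame_area_gt0 tX u; have W0' := tame_area_gt0 tY v.
have c0' := tame_c tY.
have G0 : 0 < gram_det X Y u v * Num.sqrt (gram_det X Y u v).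
  by rewrite mulr_gt0 ?sqrtr_gt0 ?(gram_det_gt0 tX tY).
rewrite /cot_deriv normrM normfV [X in _ / X]gtr0_norm// ler_pdivrMr//.
rewrite /curvature_bound; set S := _ * Num.sqrt _ in G0 *.
have -> : (1 + c' ^+ 3) * (g00 X u / gram_area X u) *
  (g11 X u * g11 Y v * gram_area X u * gram_area Y v / S) * S =
  g00 X u * g11 X u * ((1 + c' ^+ 3) * (g11 Y v * gram_area Y v)).
  by field; rewrite !gt_eqF.
rewrite normrM [X in X * _]gtr0_norm ?mulr_gt0//.
apply: ler_wpM2l; first by rewrite mulr_ge0 ?ltW.
rewrite mulrDl mul1r; apply: (le_trans (ler_normD _ _)); apply: lerD.
  by rewrite gtr0_norm ?mulr_gt0.
rewrite normrM gtr0_norm//.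
have -> : c' ^+ 3 * (g11 Y v * gram_area Y v) =
  (c' ^+ 2 * g11 Y v) * (c' * gram_area Y v) by ring.
apply: ler_pM => //; first exact: ltW.
  exact: tame_00_le tY v.
exact: tame_turn_le tY v.
Qed.

Lemma integrable_cot_deriv u : mu.-integrable setT (EFin \o cot_deriv X Y u).
Proof.
have A0 := tame_00_gt0 tX u; have W0 := tame_area_gt0 tX u.
have c0 := tame_c tX; have c0' := tame_c tY.
have K0 : 0 <= (1 + c' ^+ 3) * (g00 X u / gram_area X u).
  apply: mulr_ge0; first by rewrite addr_ge0 ?exprn_ge0.
  by apply: divr_ge0; exact: ltW.
apply: (integrable_le_bell tY (@continuous_cot_deriv R X Y b c b' c' tX tY u)
  (K := (1 + c' ^+ 3) * (g00 X u / gram_area X u) * (c * c' ^+ 2))).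
  by rewrite mulr_ge0// mulr_ge0// sqr_ge0.
move=> v; apply: le_trans (cot_deriv_le u v) _.
rewrite -[leRHS]mulrA; apply: ler_wpM2l => //.
apply: le_trans (curvature_bound_le tX tY u v) _.
rewrite -mulrA; apply: ler_wpM2l => //; apply: ler_wpM2l; first exact: sqr_ge0.
exact: bell_sqr_le tY v.
Qed.

Lemma integral_cot_deriv u :
  (\int[mu]_v (cot_deriv X Y u v)%:E = (2 / Num.sqrt (gram_area X u))%:E)%E.
Proof.
have -> : 2 / Num.sqrt (gram_area X u) =
  (Num.sqrt (gram_area X u))^-1 - - (Num.sqrt (gram_area X u))^-1 by ring.
have b0' := tame_b tY.
apply: (integral_setT_FTC (@continuous_cot_deriv R X Y b c b' c' tX tY u)
  (integrable_cot_deriv u) (@is_derive_cot R X Y b c b' c' tX tY u)).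
- apply: (cvg_cot_neg tX tY); [exact: cvgNy_bell|exact: tame_01_neg tY].
- apply: (cvg_cot_pos tX tY); [exact: cvgy_bell|exact: tame_01_pos tY].
Qed.

Lemma measurable_fst (f : R -> R) : continuous f ->
  measurable_fun setT (fun z : measurableTypeR R * measurableTypeR R => f z.1).
Proof.
move=> cf; apply: (@measurableT_comp _ _ _ _ _ _ f _ fst) => //.
exact: continuous_measurable_fun.
Qed.

Lemma measurable_snd (f : R -> R) : continuous f ->
  measurable_fun setT (fun z : measurableTypeR R * measurableTypeR R => f z.2).
Proof.
move=> cf; apply: (@measurableT_comp _ _ _ _ _ _ f _ snd) => //.
exact: continuous_measurable_fun.
Qed.

Lemma measurable_cot_deriv : measurable_fun setT
  (fun z : measurableTypeR R * measurableTypeR R => cot_deriv X Y z.1 z.2).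
Proof.
have mG : measurable_fun setT
    (fun z : measurableTypeR R * measurableTypeR R => gram_det X Y z.1 z.2).
  apply: measurable_funB; apply: measurable_funM.
  - apply: measurable_funM; apply: measurable_fst.
      exact: tame_c00 tX.
    exact: tame_c11 tX.
  - apply: measurable_funM; apply: measurable_snd.
      exact: tame_c00 tY.
    exact: tame_c11 tY.
  - by apply: measurable_funX; apply: measurable_fst; exact: tame_c01 tX.
  - by apply: measurable_funX; apply: measurable_snd; exact: tame_c01 tY.
apply: measurable_funM; last first.
  apply: measurable_fun_inv_gt0; last first.
    by move=> z; rewrite mulr_gt0 ?sqrtr_gt0 ?(gram_det_gt0 tX tY).
  apply: measurable_funM => //.
  apply: (@measurableT_comp _ _ _ _ _ _ (@Num.sqrt R)) => //.
  apply: continuous_measurable_fun; exact: sqrt_continuous.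
apply: measurable_funM.
  apply: measurable_funM; apply: measurable_fst.
    exact: tame_c00 tX.
  exact: tame_c11 tX.
apply: measurable_funD; apply: measurable_funM; apply: measurable_snd.
- exact: tame_c11 tY.
- exact: continuous_gram_area tY.
- exact: tame_c00 tY.
- exact: continuous_gram_turn tY.
Qed.

(** Tonelli: the dominating product of bells has a finite iterated integral. *)
Lemma integrable_prod_bell (f : R -> R -> R) K : 0 <= K ->
  measurable_fun setT
    (fun z : measurableTypeR R * measurableTypeR R => f z.1 z.2) ->
  (forall u v, `|f u v| <= K * (bell b u * bell b' v)) ->
  (mu \x mu)%E.-integrable setT (fun z => (f z.1 z.2)%:E).
Proof.
move=> K0 mf fK.
have ib := integrable_bell (tame_b tX); have ib' := integrable_bell (tame_b tY).
have mb : measurable_fun setT (fun z : measurableTypeR R * measurableTypeR R =>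
    K * (bell b z.1 * bell b' z.2)).
  apply: measurable_funM => //; apply: measurable_funM.
    by apply: measurable_fst; exact: continuous_bell.
  by apply: measurable_snd; exact: continuous_bell.
have gi : (mu \x mu)%E.-integrable setT
    (fun z => (K * (bell b z.1 * bell b' z.2))%:E).
  apply/integrable12ltyP; first exact/measurable_EFinP.
  have [I IE] : exists I : R, (\int[mu]_v (bell b' v)%:E = I%:E)%E.
    exists (fine (\int[mu]_v (bell b' v)%:E)%E).
    by rewrite fineK//; exact: integrable_fin_num ib'.
  have -> : (\int[mu]_u \int[mu]_v `|(K * (bell b u * bell b' v))%:E| =
      \int[mu]_u ((K * I)%:E * (bell b u)%:E))%E.
    apply: eq_integral => u _.
    transitivity (\int[mu]_v ((K * bell b u)%:E * (bell b' v)%:E))%E.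
      apply: eq_integral => v _; rewrite -EFinM gee0_abs ?mulrA//.
      by rewrite lee_fin !mulr_ge0// ltW// bell_gt0.
    rewrite integralZl// IE -!EFinM; congr _%:E; ring.
  exact: integral_fune_lt_pinfty (integrableZl measurableT (K * I) ib).
apply: (le_integrable measurableT _ _ gi).
- exact/measurable_EFinP.
- by move=> z _ /=; rewrite lee_fin (le_trans (fK _ _))// ler_norm.
Qed.

End Pair.

End GaussBonnet.

(** * Integrating the two fluxes by Fubini *)

Section TotalCurvature.
Variables (R : realType) (X Y : gram R) (b c b' c' : R).
Hypotheses (tX : tame X b c) (tY : tame Y b' c').
Notation mu := (@lebesgue_measure R).

Let flux_u (z : measurableTypeR R * measurableTypeR R) : R :=
  gram_turn X z.1 / g11 X z.1 * cot_deriv X Y z.1 z.2.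

Let flux_v (z : measurableTypeR R * measurableTypeR R) : R :=
  gram_area Y z.2 / g00 Y z.2 * cot_deriv Y X z.2 z.1.

Let integrable_flux_u : (mu \x mu)%E.-integrable setT (EFin \o flux_u).
Proof.
have c0 := tame_c tX; have c0' := tame_c tY.
(* The factor c^3 is c from |T| <= c W times c^2 from A <= c^2 B; the other two come from
   [cot_deriv_le] and [curvature_bound_le_bell]. *)
apply: (@integrable_prod_bell _ _ _ _ _ _ _ tX tY
   (fun u v => gram_turn X u / g11 X u * cot_deriv X Y u v)
   (c ^+ 3 * (1 + c' ^+ 3) * (1 + (c * c') ^+ 3))).
- by rewrite !mulr_ge0 ?addr_ge0 ?exprn_ge0 ?mulr_ge0.
- apply: measurable_funM; last exact: measurable_cot_deriv tX tY.
  apply: (@measurable_fst _ (fun u => gram_turn X u / g11 X u)) => u.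
  apply: cvgM; first exact: continuous_gram_turn tX u.
  by apply: cvgV; [rewrite gt_eqF// (tame_11_gt0 tX)|exact: tame_c11 tX u].
move=> u v.
have B0 := tame_11_gt0 tX u; have W0 := tame_area_gt0 tX u.
have A0 := tame_00_gt0 tX u.
have N0 := curvature_bound_ge0 tX tY u v.
have hT : `|gram_turn X u / g11 X u| <= c * gram_area X u / g11 X u.
  rewrite normrM normfV (gtr0_norm B0); apply: ler_wpM2r.
    by rewrite invr_ge0 ltW.
  exact: tame_turn_le tX u.
rewrite normrM; apply: (le_trans (ler_pM _ _ hT (cot_deriv_le tX tY u v))) => //.
have -> : c * gram_area X u / g11 X u *
   ((1 + c' ^+ 3) * (g00 X u / gram_area X u) * curvature_bound X Y u v) =
   g00 X u / g11 X u * (c * (1 + c' ^+ 3) * curvature_bound X Y u v).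
  by field; rewrite !gt_eqF.
apply: (@le_trans _ _ (c ^+ 2 * (c * (1 + c' ^+ 3) * curvature_bound X Y u v))).
  apply: ler_wpM2r.
    by apply: mulr_ge0 => //; rewrite mulr_ge0 ?addr_ge0 ?exprn_ge0.
  by rewrite ler_pdivrMr// (tame_00_le tX).
have -> : c ^+ 2 * (c * (1 + c' ^+ 3) * curvature_bound X Y u v) =
  c ^+ 3 * (1 + c' ^+ 3) * curvature_bound X Y u v by ring.
rewrite -[leRHS]mulrA; apply: ler_wpM2l.
  by rewrite !mulr_ge0 ?addr_ge0 ?exprn_ge0.
exact: curvature_bound_le_bell tX tY u v.
Qed.

(** The coefficient W' / D cancels exactly the factor D / W' left by [cot_deriv_le], so no power of
    c arises from it. *)
Let integrable_flux_v : (mu \x mu)%E.-integrable setT (EFin \o flux_v).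
Proof.
have c0 := tame_c tX; have c0' := tame_c tY.
apply: (@integrable_prod_bell _ _ _ _ _ _ _ tX tY
   (fun u v => gram_area Y v / g00 Y v * cot_deriv Y X v u)
   ((1 + c ^+ 3) * (1 + (c * c') ^+ 3))).
- by rewrite !mulr_ge0 ?addr_ge0 ?exprn_ge0 ?mulr_ge0.
- apply: measurable_funM; last first.
    apply: (@measurableT_comp _ _ _ _ _ _
      (fun z : measurableTypeR R * measurableTypeR R => cot_deriv Y X z.1 z.2)
      _ (fun z => (z.2, z.1))); first exact: measurable_cot_deriv tY tX.
    exact: measurable_swap.
  apply: (@measurable_snd _ (fun v => gram_area Y v / g00 Y v)) => v.
  apply: cvgM; first exact: continuous_gram_area tY v.
  by apply: cvgV; [rewrite gt_eqF// (tame_00_gt0 tY)|exact: tame_c00 tY v].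
move=> u v.
have D0 := tame_00_gt0 tY v; have W0 := tame_area_gt0 tY v.
rewrite normrM gtr0_norm ?divr_gt0//.
have r0 : 0 <= gram_area Y v / g00 Y v by apply: divr_ge0; exact: ltW.
apply: (le_trans (ler_wpM2l r0 (cot_deriv_le tY tX v u))).
rewrite -curvature_boundC.
have -> : gram_area Y v / g00 Y v *
   ((1 + c ^+ 3) * (g00 Y v / gram_area Y v) * curvature_bound X Y u v) =
   (1 + c ^+ 3) * curvature_bound X Y u v.
  by field; rewrite !gt_eqF.
rewrite -[leRHS]mulrA; apply: ler_wpM2l.
  by rewrite addr_ge0 ?exprn_ge0.
exact: curvature_bound_le_bell tX tY u v.
Qed.

Let integral_flux_u : (\int[mu \x mu]_z (flux_u z)%:E =
  2%:E * \int[mu]_u (theta_density X u)%:E)%E.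
Proof.
rewrite -(integral12_prod_meas1 integrable_flux_u).
rewrite -(integralZl measurableT (integrable_theta_density tX)).
apply: eq_integral => u _; rewrite /fubini_F /=.
transitivity (\int[mu]_v ((gram_turn X u / g11 X u)%:E * (cot_deriv X Y u v)%:E))%E.
  by apply: eq_integral => v _; rewrite -EFinM.
rewrite (integralZl measurableT (integrable_cot_deriv tX tY u)).
rewrite (integral_cot_deriv tX tY) -!EFinM; congr _%:E.
have B0 := tame_11_gt0 tX u.
have w0 : 0 < Num.sqrt (gram_area X u) by rewrite sqrtr_gt0 (tame_area_gt0 tX).
by rewrite /theta_density; field; rewrite !gt_eqF.
Qed.

(** Here u is integrated first: the flux is a u-derivative times a function of v. *)
Let integral_flux_v : (\int[mu \x mu]_z (flux_v z)%:E =
  2%:E * \int[mu]_v (rotation_density Y v)%:E)%E.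
Proof.
rewrite -(integral21_prod_meas1 integrable_flux_v).
rewrite -(integralZl measurableT (integrable_rotation_density tY)).
apply: eq_integral => v _; rewrite /fubini_G /=.
transitivity (\int[mu]_u ((gram_area Y v / g00 Y v)%:E * (cot_deriv Y X v u)%:E))%E.
  by apply: eq_integral => u _; rewrite -EFinM.
rewrite (integralZl measurableT (integrable_cot_deriv tY tX v)).
rewrite (integral_cot_deriv tY tX) -!EFinM; congr _%:E.
have D0 := tame_00_gt0 tY v; have W0 := tame_area_gt0 tY v.
have w0 : 0 < Num.sqrt (gram_area Y v) by rewrite sqrtr_gt0.
rewrite /rotation_density -{1}(sqr_sqrtr (ltW W0)).
by field; rewrite !gt_eqF.
Qed.

(** The fluxes give twice the theta integral of X minus twice the rotation integral of Y; the angle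
    identity for Y trades the latter for pi minus its theta integral, which restores the
    symmetry. *)
Lemma gauss_bonnet_gram :
  (0 = \int[mu \x mu]_z (curvature_density X Y z.1 z.2)%:E
       - 2%:E * \int[mu]_t (theta_density X t)%:E
       - 2%:E * \int[mu]_t (theta_density Y t)%:E + (2 * pi)%:E)%E.
Proof.
have -> : (\int[mu \x mu]_z (curvature_density X Y z.1 z.2)%:E =
    \int[mu \x mu]_z ((flux_u z)%:E - (flux_v z)%:E))%E.
  apply: eq_integral => z _; rewrite -EFinB curvature_density_split//.
    by rewrite gt_eqF// (tame_00_gt0 tY).
  by rewrite gt_eqF// (tame_11_gt0 tX).
rewrite (integralB_EFin measurableT integrable_flux_u integrable_flux_v).
rewrite integral_flux_u integral_flux_v.
have tot := integral_rotation_theta tY.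
have : (\int[mu]_t (rotation_density Y t)%:E + \int[mu]_t (theta_density Y t)%:E
    = pi%:E)%E.
  rewrite -tot -(integralD_EFin measurableT (integrable_rotation_density tY)
    (integrable_theta_density tY)).
  by apply: eq_integral => t _; rewrite EFinD.
(* Finiteness of the three integrals brings the extended-real equation down to a ring identity. *)
have := integrable_fin_num measurableT (integrable_theta_density tX).
have := integrable_fin_num measurableT (integrable_theta_density tY).
have := integrable_fin_num measurableT (integrable_rotation_density tY).
rewrite /= => /fineK <- /fineK <- /fineK <-.
rewrite -EFinD => -[<-].
by rewrite -!EFinM -!EFinB -EFinD; congr _%:E; ring.
Qed.

End TotalCurvature.

(** * Curves with linear velocity *)

Lemma ord2_cases (a : 'I_2) : a = 0 \/ a = 1.
Proof. by case: a => -[|[|//]] ?; [left|right]; exact/val_inj. Qed.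

(** * Coordinates of a 2-vector *)

Section Minors.
Variables (R : realType) (n : nat).
Implicit Types (u v a b : 'rV[R]_n) (M : 'M[R]_n).

(** The Plucker coordinates of u /\ v. Indexing by all ordered pairs avoids sums over i < j. *)
Definition minor u v (i : 'I_n * 'I_n) : R := u 0 i.1 * v 0 i.2 - u 0 i.2 * v 0 i.1.

Lemma det_mx22 (A : 'M[R]_2) : \det A = A 0 0 * A 1 1 - A 0 1 * A 1 0.
Proof.
rewrite (expand_det_row _ 0) !big_ord_recl big_ord0 addr0 /cofactor !det_mx11.
rewrite !mxE /= expr0 expr1 mul1r.
have -> : lift 0 0 = 1 :> 'I_2 by exact/val_inj.
have -> : lift 1 0 = 0 :> 'I_2 by exact/val_inj.
by ring.
Qed.

Lemma wedge_dotpE u v a b :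
  wedge_dotp u v a b = dotp u a * dotp v b - dotp u b * dotp v a.
Proof. by rewrite /wedge_dotp det_mx22 !mxE. Qed.

Lemma dotpC u v : dotp u v = dotp v u.
Proof. by apply: eq_bigr => j _; rewrite mulrC. Qed.

(* The Cauchy-Binet identity; every unordered pair is counted twice. *)
Lemma sum_minors u v a b :
  \sum_i minor u v i * minor a b i = 2 * wedge_dotp u v a b.
Proof.
rewrite -(pair_bigA _ (fun i j => minor u v (i, j) * minor a b (i, j))) /=.
rewrite wedge_dotpE /dotp !big_distrlr /=.
rewrite mulr_natl mulr2n [X in _ = _ + (X - _)]exchange_big /=.
rewrite [X in _ = _ + (_ - X)]exchange_big /=.
rewrite -!sumrB -!big_split /=; apply: eq_bigr => i _.
rewrite -!sumrB -!big_split /=; apply: eq_bigr => j _.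
by rewrite /minor /=; ring.
Qed.

(** The action of M on the second exterior power. It makes s' /\ s'' a linear image of s /\ s', the
    source of the bound on [gram_turn]. *)
Lemma minor_mulmx M u v i : minor (u *m M) (v *m M) i =
  \sum_(k : 'I_n * 'I_n) M k.1 i.1 * M k.2 i.2 * minor u v k.
Proof.
rewrite -(pair_bigA _ (fun k l => M k i.1 * M l i.2 * minor u v (k, l))) /=.
rewrite /minor !mxE !big_distrlr /= [X in _ - X]exchange_big /= -sumrB.
apply: eq_bigr => k _; rewrite -sumrB; apply: eq_bigr => l _; ring.
Qed.

(** Cauchy-Schwarz against the constant 1, by comparing each f i f j with the mean of the two
    squares. *)
Lemma sqr_sum_le (I : finType) (f : I -> R) :
  (\sum_i f i) ^+ 2 <= #|I|%:R * \sum_i f i ^+ 2.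
Proof.
rewrite expr2 big_distrlr /=.
have -> : #|I|%:R * (\sum_i f i ^+ 2) =
    \sum_i \sum_j (f i ^+ 2 + f j ^+ 2) / 2.
  under [RHS]eq_bigr do rewrite -mulr_suml big_split /= sumr_const.
  rewrite -mulr_suml big_split /= sumr_const sumrMnl -mulr2n.
  rewrite -[X in X / _]mulr_natr mulfK//.
  by rewrite mulr_natl.
apply: ler_sum => i _; apply: ler_sum => j _.
have := sqr_ge0 (f i - f j); nra.
Qed.

End Minors.

Section LinearCurve.
Variables (R : realType) (n : nat) (M : 'M[R]_n) (sigma : R -> 'rV[R]_n).

(* sigma' = sigma M *)
Definition linear_curve := forall (t : R) (j : 'I_n),
  is_derive t 1 (fun t => sigma t 0 j) ((sigma t *m M) 0 j).

Definition vel t := sigma t *m M.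
Definition acc t := vel t *m M.

Definition gram_of : gram R := Gram
  (fun t => dotp (sigma t) (sigma t)) (fun t => dotp (sigma t) (vel t))
  (fun t => dotp (vel t) (vel t)) (fun t => dotp (sigma t) (acc t))
  (fun t => dotp (vel t) (acc t)).

Hypothesis lin : linear_curve.

Lemma is_derive_sum_fun (f : 'I_n -> R -> R) (df : 'I_n -> R) (t : R) :
  (forall i, is_derive t 1 (f i) (df i)) ->
  is_derive t 1 (fun t => \sum_i f i t) (\sum_i df i).
Proof. by move=> h; have := is_derive_sum h; rewrite fct_sumE. Qed.

Lemma is_derive_mulmx (u : R -> 'rV[R]_n) (du : 'rV[R]_n) (t : R) :
  (forall j, is_derive t 1 (fun t => u t 0 j) (du 0 j)) ->
  forall j, is_derive t 1 (fun t => (u t *m M) 0 j) ((du *m M) 0 j).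
Proof.
move=> h j.
have -> : (fun t => (u t *m M) 0 j) = (fun t => \sum_k u t 0 k * M k j).
  by apply/funext => x; rewrite mxE.
rewrite mxE; apply: is_derive_sum_fun => k.
by apply: is_derive_eq (is_derive_mul (h k) (is_derive_const (M k j) t)) _; ring.
Qed.

Lemma is_derive_vel (t : R) j : is_derive t 1 (fun t => vel t 0 j) (acc t 0 j).
Proof. exact: is_derive_mulmx. Qed.

Lemma is_derive_acc (t : R) j :
  is_derive t 1 (fun t => acc t 0 j) ((acc t *m M) 0 j).
Proof. by apply: is_derive_mulmx => k; exact: is_derive_vel. Qed.

Lemma is_derive_dotp (u v : R -> 'rV[R]_n) (du dv : 'rV[R]_n) (t : R) :
  (forall j, is_derive t 1 (fun t => u t 0 j) (du 0 j)) ->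
  (forall j, is_derive t 1 (fun t => v t 0 j) (dv 0 j)) ->
  is_derive t 1 (fun t => dotp (u t) (v t)) (dotp du (v t) + dotp (u t) dv).
Proof.
move=> hu hv; rewrite /dotp -big_split /=; apply: is_derive_sum_fun => k.
exact: is_derive_mul.
Qed.

Lemma derive1_rV (u : R -> 'rV[R]_n) (du : R -> 'rV[R]_n) :
  (forall (t : R) j, is_derive t 1 (fun t => u t 0 j) (du t 0 j)) ->
  derive1 u = du.
Proof.
move=> h; apply/funext => t.
have hd : derivable u t 1.
  by apply/derivable_mxP => i j; rewrite ord1; have := h t j; case.
rewrite derive1E derive_mx//; apply/rowP => j; rewrite mxE.
by have [_ <-] := h t j.
Qed.

Lemma derive1_curve : derive1 sigma = vel.
Proof. exact: derive1_rV. Qed.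

Lemma derive2_curve : derive1n 2 sigma = acc.
Proof. by rewrite derive1nS derive1n1 derive1_curve; exact/derive1_rV/is_derive_vel. Qed.

Lemma theta_integrandE t : Theta_integrand sigma t = theta_density gram_of t.
Proof.
rewrite /Theta_integrand derive1_curve derive2_curve /theta_density.
rewrite /wedge_norm !wedge_dotpE /gram_turn /gram_area /=.
rewrite (dotpC (vel t) (sigma t)) sqr_sqrtr; last first.
  by apply: sumr_ge0 => j _; rewrite -expr2 sqr_ge0.
congr (_ / _); first by ring.
by rewrite mulrC; congr (_ * Num.sqrt _); ring.
Qed.

Lemma continuous_dotp (u v du dv : R -> 'rV[R]_n) :
  (forall (t : R) j, is_derive t 1 (fun t => u t 0 j) (du t 0 j)) ->
  (forall (t : R) j, is_derive t 1 (fun t => v t 0 j) (dv t 0 j)) ->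
  continuous (fun t => dotp (u t) (v t)).
Proof.
move=> hu hv.
exact: is_derive_continuous (fun t => is_derive_dotp (hu t) (hv t)).
Qed.

End LinearCurve.

(** * From exponential growth rates to the bounds of [tame] *)

Section DominatedCurve.
Variables (R : realType) (n : nat) (M : 'M[R]_n) (sigma : R -> 'rV[R]_n).
Variables (rho : 'I_n -> R) (m : R) (top bot : 'I_n).
Hypothesis lin : linear_curve M sigma.
Hypothesis sigma_le : forall t j, `|sigma t 0 j| <= expR (rho j * t).
Hypothesis vel_le : forall t j, `|(sigma t *m M) 0 j| <= m * expR (rho j * t).
Hypothesis sigma_top : forall t, sigma t 0 top = expR (rho top * t).
Hypothesis sigma_bot : forall t, sigma t 0 bot = expR (rho bot * t).
Hypothesis rho_top_gt0 : 0 < rho top.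
Hypothesis rho_bot_lt0 : rho bot < 0.
Hypothesis rho_lt_top : forall j, j != top -> rho j < rho top.
Hypothesis rho_gt_bot : forall j, j != bot -> rho bot < rho j.

(** The size of the curve up to constants: every coordinate lies below it, and the two extreme
    coordinates alone bound it from above. *)
Let envelope (t : R) := expR (rho top * t) + expR (rho bot * t).

Let env_gt0 t : 0 < envelope t.
Proof. by rewrite addr_gt0 ?expR_gt0. Qed.

Let m_ge0 : 0 <= m.
Proof.
by have := le_trans (normr_ge0 _) (vel_le 0 top); rewrite mulr0 expR0 mulr1.
Qed.

Let expR_le_envelope (r t : R) : rho bot <= r <= rho top ->
  expR (r * t) <= envelope t.
Proof.
move=> /andP[r1 r2]; rewrite /envelope; case: (leP 0 t) => t0.
  apply: (@le_trans _ _ (expR (rho top * t))); last by rewrite lerDl expR_ge0.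
  by rewrite ler_expR ler_wpM2r.
apply: (@le_trans _ _ (expR (rho bot * t))); last by rewrite lerDr expR_ge0.
by rewrite ler_expR ler_wnM2r// ltW.
Qed.

Let rho_itv j : rho bot <= rho j <= rho top.
Proof.
apply/andP; split.
  by have [->//|/rho_gt_bot/ltW] := eqVneq j bot.
by have [->//|/rho_lt_top/ltW] := eqVneq j top.
Qed.

Let top_neq_bot : top != bot.
Proof. by apply/eqP => e; have := lt_trans rho_bot_lt0 rho_top_gt0; rewrite e ltxx. Qed.

(** Finitely many rates turn strict dominance into a uniform gap; [bot] and [top] witness that the
    index ranges of the maximum and of the minimum are nonempty. *)
Let ex_gap : exists2 d, 0 < d &
  (forall j, j != top -> rho j <= rho top - d) /\
  (forall j, j != bot -> rho bot + d <= rho j).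
Proof.
have [d1 d10 h1] : exists2 d, 0 < d & forall j, j != top -> rho j <= rho top - d.
  have bt : bot != top by rewrite eq_sym.
  exists (rho top - rho [arg max_(j > bot | j != top) rho j]%O).
    by case: Order.TotalTheory.arg_maxP => // i it _; rewrite subr_gt0 rho_lt_top.
  move=> j jt; case: Order.TotalTheory.arg_maxP => // i it /(_ j jt) /= h.
  by rewrite opprB addrC subrK.
have [d2 d20 h2] : exists2 d, 0 < d & forall j, j != bot -> rho bot + d <= rho j.
  exists (rho [arg min_(j < top | j != bot) rho j]%O - rho bot).
    by case: Order.TotalTheory.arg_minP => // i it _; rewrite subr_gt0 rho_gt_bot.
  move=> j jt; case: Order.TotalTheory.arg_minP => // i it /(_ j jt) /= h.
  by rewrite addrC subrK.
exists (Num.min d1 d2); first by rewrite lt_min d10.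
split=> j jt.
  by apply: le_trans (h1 j jt) _; rewrite lerD2l lerN2 ge_min lexx.
by apply: le_trans (h2 j jt); rewrite lerD2l ge_min lexx orbT.
Qed.

(* Uniqueness of derivatives pins down the velocity in the two extreme
   directions. *)
Let vel_exp j t : (forall t, sigma t 0 j = expR (rho j * t)) ->
  (sigma t *m M) 0 j = rho j * expR (rho j * t).
Proof.
move=> h; have [_ <-] := lin t j.
rewrite (_ : (fun t => sigma t 0 j) = fun t => expR (rho j * t)); last exact/funext.
by have [_ <-] := is_derive_expRM (rho j) t.
Qed.

Let G := gram_of M sigma.

Let pair_le_dotp (u : 'rV[R]_n) : u 0 top ^+ 2 + u 0 bot ^+ 2 <= dotp u u.
Proof.
rewrite /dotp (bigD1 top)//= (bigD1 bot)/=; last by rewrite eq_sym.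
rewrite -!expr2 addrA lerDl; apply: sumr_ge0 => j _; exact: sqr_ge0.
Qed.

Let envelope_sqr_le t :
  envelope t ^+ 2 <= 2 * (expR (rho top * t) ^+ 2 + expR (rho bot * t) ^+ 2).
Proof.
have := sqr_ge0 (expR (rho top * t) - expR (rho bot * t)).
rewrite /envelope; nra.
Qed.

Let g00_ge t : envelope t ^+ 2 <= 2 * g00 G t.
Proof.
apply: le_trans (envelope_sqr_le t) _; apply: ler_wpM2l => //.
by rewrite -sigma_top -sigma_bot; exact: pair_le_dotp.
Qed.

(** Compensates for the factors [rho top] and [rho bot] that differentiation puts on the extreme
    coordinates: a + b <= (1/x + 1/y) (x a + y b) for positive x, y and nonnegative a, b. *)
Let kappa := (rho top ^- 2 + rho bot ^- 2).

Let kappa_ge0 : 0 <= kappa.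
Proof. by rewrite addr_ge0// invr_ge0 sqr_ge0. Qed.

Let g11_ge t : envelope t ^+ 2 <= 2 * kappa * g11 G t.
Proof.
apply: le_trans (envelope_sqr_le t) _; rewrite -mulrA; apply: ler_wpM2l => //.
apply: le_trans (ler_wpM2l kappa_ge0 (pair_le_dotp _)).
rewrite /vel !vel_exp// !exprMn /kappa.
have x0 : 0 < rho top ^+ 2 by rewrite exprn_gt0.
have y0 : 0 < rho bot ^+ 2 by rewrite -sqrrN exprn_gt0// oppr_gt0.
have a0 := sqr_ge0 (expR (rho top * t)); have b0 := sqr_ge0 (expR (rho bot * t)).
move: (rho top ^+ 2) (rho bot ^+ 2) (expR (rho top * t) ^+ 2)
  (expR (rho bot * t) ^+ 2) x0 y0 a0 b0.
move=> x y a b x0 y0 a0 b0.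
have -> : (x^-1 + y^-1) * (x * a + y * b) = a + b + (x^-1 * y * b + y^-1 * x * a).
  by field; rewrite !gt_eqF.
have xi : 0 <= x^-1 by rewrite invr_ge0 ltW.
have yi : 0 <= y^-1 by rewrite invr_ge0 ltW.
by rewrite lerDl addr_ge0// mulr_ge0// mulr_ge0// ltW.
Qed.

Let sum_sqr_le (I : finType) (f : I -> R) (e : R) : 0 <= e ->
  (forall i, `|f i| <= e) -> \sum_i f i ^+ 2 <= #|I|%:R * e ^+ 2.
Proof.
move=> e0 h; rewrite mulr_natl -sumr_const.
apply: ler_sum => i _; rewrite -real_normK ?num_real//.
by rewrite ler_pXn2r// nnegrE.
Qed.

Let dotp_le (u : 'rV[R]_n) (e : R) : 0 <= e -> (forall j, `|u 0 j| <= e) ->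
  dotp u u <= n%:R * e ^+ 2.
Proof.
move=> e0 h; rewrite -[X in X%:R]card_ord.
exact: le_trans (sum_sqr_le e0 h).
Qed.

Let g00_le t : g00 G t <= n%:R * envelope t ^+ 2.
Proof.
apply: dotp_le; first exact: ltW.
by move=> j; apply: le_trans (sigma_le t j) _; exact: expR_le_envelope.
Qed.

Let g11_le t : g11 G t <= n%:R * m ^+ 2 * envelope t ^+ 2.
Proof.
rewrite -mulrA -exprMn; apply: dotp_le; first by rewrite mulr_ge0// ltW.
move=> j; apply: le_trans (vel_le t j) _; apply: ler_wpM2l => //.
exact: expR_le_envelope.
Qed.

Let gram_areaE t : gram_area G t =
  (\sum_i minor (sigma t) (vel M sigma t) i ^+ 2) / 2.
Proof.
apply/(canRL (mulfK _)) => //; under eq_bigr do rewrite expr2.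
rewrite sum_minors wedge_dotpE mulrC /gram_area /=.
by congr (_ * (_ - _)); rewrite expr2; congr (_ * _); exact: dotpC.
Qed.

Let g00_gt0 t : 0 < g00 G t.
Proof.
rewrite -(pmulr_rgt0 _ (ltr0n R 2)) (lt_le_trans _ (g00_ge t))//.
by rewrite exprn_gt0.
Qed.

(** The minor of the two extreme coordinates suffices: it is a product of exponentials times
    [rho bot - rho top]. *)
Let area_gt0 t : 0 < gram_area G t.
Proof.
rewrite gram_areaE divr_gt0// (bigD1 (top, bot))//= ltr_wpDr//.
  by apply: sumr_ge0 => i _; exact: sqr_ge0.
rewrite /minor /vel /= !vel_exp// sigma_top sigma_bot.
rewrite lt_neqAle sqr_ge0 andbT eq_sym expf_neq0//.
rewrite (_ : _ - _ =
  expR (rho top * t) * expR (rho bot * t) * (rho bot - rho top)); last by ring.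
have bt : rho bot - rho top != 0.
  by rewrite lt_eqF// subr_lt0 (lt_trans rho_bot_lt0).
by rewrite !mulf_neq0// gt_eqF ?expR_gt0.
Qed.

Let mu := \big[Num.max/0]_(i : 'I_n * 'I_n) `|M i.1 i.2|.

(** T is bilinear in s /\ s' and s' /\ s'', and the latter is linear in the former with coefficients
    at most [mu ^+ 2]; the factor n * n is the cost of passing from the squared sum of absolute
    values of the minors to their sum of squares. *)
Let turn_le t : `|gram_turn G t| <= mu ^+ 2 * (n * n)%:R * gram_area G t.
Proof.
have M_le k l : `|M k l| <= mu by exact: (le_bigmax _ _ (k, l)).
have mu0 : 0 <= mu by exact: bigmax_ge_id.
have -> : gram_turn G t =
    - (\sum_i minor (sigma t) (vel M sigma t) i
         * minor (vel M sigma t) (acc M sigma t) i) / 2.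
  rewrite sum_minors wedge_dotpE /gram_turn /=.
  by field.
pose S := \sum_i `|minor (sigma t) (vel M sigma t) i|.
have S0 : 0 <= S by exact: sumr_ge0.
have acc_le i : `|minor (vel M sigma t) (acc M sigma t) i| <= mu ^+ 2 * S.
  rewrite /acc {1}/vel minor_mulmx; apply: le_trans (ler_norm_sum _ _ _) _.
  rewrite /S mulr_sumr; apply: ler_sum => k _.
  rewrite normrM normrM; apply: ler_wpM2r => //.
  by rewrite expr2; apply: ler_pM.
rewrite normrM normrN normfV (ger0_norm (ler0n R 2)) gram_areaE mulrA.
apply: ler_wpM2r; first by rewrite invr_ge0.
apply: (@le_trans _ _ (mu ^+ 2 * S ^+ 2)).
  apply: le_trans (ler_norm_sum _ _ _) _.
  rewrite [S ^+ 2]expr2 mulrA mulrC {1}/S mulr_suml; apply: ler_sum => i _.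
  by rewrite normrM; apply: ler_wpM2l.
rewrite -mulrA; apply: ler_wpM2l; first exact: sqr_ge0.
have := sqr_sum_le (fun i => `|minor (sigma t) (vel M sigma t) i|).
rewrite card_prod card_ord => h; apply: le_trans h _.
apply: ler_wpM2l => //; apply: ler_sum => i _.
by rewrite real_normK ?num_real.
Qed.

(** As r stays d away from both ends, exp((r + d) t) and exp((r - d) t) are still below
    [envelope t ^+ 2], which gains exp(d |t|). The parameter d / 4 matches that gain to the fourth
    power of the denominator of [bell]; 16 is the 8 of the power-mean inequality times these two
    exponentials. *)
Let expR_le_bell (d r t : R) : 2 * rho bot + d <= r <= 2 * rho top - d ->
  0 < d -> expR (r * t) <= 16 * envelope t ^+ 2 * bell (d / 4) t ^+ 2.
Proof.
move=> /andP[r1 r2] d0.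
have sq (q : R) : 2 * rho bot <= q <= 2 * rho top -> expR (q * t) <= envelope t ^+ 2.
  move=> /andP[q1 q2]; have -> : q * t = 2%:R * (q / 2 * t) by field.
  rewrite expRM_natl ler_pXn2r// ?nnegrE ?expR_ge0 ?(ltW (env_gt0 _))//.
  by apply: expR_le_envelope; apply/andP; split; lra.
rewrite /bell -exprVn -exprM.
set x := expR (d / 4 * t); set y := expR (- (d / 4) * t).
have x0 : 0 < x by exact: expR_gt0.
have y0 : 0 < y by exact: expR_gt0.
rewrite exprVn ler_pdivlMr ?exprn_gt0 ?addr_gt0//.
have h4 : (x + y) ^+ (2 * 2) <= 8 * (x ^+ 4 + y ^+ 4).
  have a1 := sqr_ge0 (x - y); have a2 := sqr_ge0 (x ^+ 2 - y ^+ 2).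
  have b1 : (x + y) ^+ 2 <= 2 * (x ^+ 2 + y ^+ 2) by nra.
  have b2 : (x ^+ 2 + y ^+ 2) ^+ 2 <= 2 * (x ^+ 4 + y ^+ 4).
    rewrite (_ : x ^+ 4 = (x ^+ 2) ^+ 2); last by rewrite -exprM.
    rewrite (_ : y ^+ 4 = (y ^+ 2) ^+ 2); last by rewrite -exprM.
    by nra.
  rewrite exprM; apply: (@le_trans _ _ ((2 * (x ^+ 2 + y ^+ 2)) ^+ 2)).
    by rewrite ler_pXn2r// nnegrE ?sqr_ge0// mulr_ge0// addr_ge0 ?sqr_ge0.
  by rewrite exprMn; nra.
apply: (le_trans (ler_wpM2l (expR_ge0 _) h4)).
have -> : expR (r * t) * (8 * (x ^+ 4 + y ^+ 4)) =
    8 * (expR ((r + d) * t) + expR ((r - d) * t)).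
  rewrite /x /y -!expRM_natl mulrCA; congr (8 * _).
  by rewrite mulrDr -!expRD; congr (expR _ + expR _); field.
have s1 : expR ((r + d) * t) <= envelope t ^+ 2 by apply: sq; apply/andP; split; lra.
have s2 : expR ((r - d) * t) <= envelope t ^+ 2 by apply: sq; apply/andP; split; lra.
lra.
Qed.

(** Diagonal minors vanish, so 2 [rho top] and 2 [rho bot] never occur as exponents. Each minor is a
    difference of two products bounded with constant 16 m, whence 32; the sum has n^2 squares, and
    the lower bounds on [g00] and [g11] absorb the fourth power of the envelope. *)
Let area_le d t : 0 < d -> (forall j, j != top -> rho j <= rho top - d) ->
  (forall j, j != bot -> rho bot + d <= rho j) ->
  gram_area G t <= 2 * 32 ^+ 2 * n%:R ^+ 2 * m ^+ 2 * kappa * bell (d / 4) t ^+ 4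
                   * (g00 G t * g11 G t).
Proof.
move=> d0 dtop dbot.
have [a aE a0] : exists2 a : R, a = 32 & 0 <= a by exists 32.
rewrite -aE.
set e := a * m * envelope t ^+ 2 * bell (d / 4) t ^+ 2.
have e0 : 0 <= e by rewrite /e mulr_ge0 ?sqr_ge0// mulr_ge0 ?sqr_ge0// mulr_ge0.
have minor_le i : `|minor (sigma t) (vel M sigma t) i| <= e.
  case: i => j k; rewrite /minor /=; have [->|jk] := eqVneq j k.
    by rewrite subrr normr0.
  have hjk : expR ((rho j + rho k) * t) <=
      16 * envelope t ^+ 2 * bell (d / 4) t ^+ 2.
    apply: expR_le_bell => //.
    have /andP[bj tj] := rho_itv j; have /andP[bk tk] := rho_itv k.
    (* Since j and k differ, at least one is not [top] and at least one is not [bot], which gives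
       the gap at each end. *)
    have [jt|/dtop jt] := eqVneq j top; have [jb|/dbot jb] := eqVneq j bot.
    - by have := top_neq_bot; rewrite -jt -jb eqxx.
    - have /dtop kt : k != top by rewrite -jt eq_sym.
      by apply/andP; split; lra.
    - have /dbot kb : k != bot by rewrite -jb eq_sym.
      by apply/andP; split; lra.
    - by apply/andP; split; lra.
  rewrite mulrDl expRD in hjk.
  have p1 : `|sigma t 0 j * vel M sigma t 0 k| <=
      m * (expR (rho j * t) * expR (rho k * t)).
    rewrite normrM [leRHS]mulrCA; apply: ler_pM => //; exact: vel_le.
  have p2 : `|sigma t 0 k * vel M sigma t 0 j| <=
      m * (expR (rho j * t) * expR (rho k * t)).
    rewrite normrM [X in m * X]mulrC [leRHS]mulrCA.
    by apply: ler_pM => //; exact: vel_le.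
  apply: (le_trans (ler_normB _ _)); apply: (le_trans (lerD p1 p2)).
  have := ler_wpM2l m_ge0 hjk; rewrite /e aE; lra.
have := sum_sqr_le e0 minor_le; rewrite card_prod card_ord natrM => h.
rewrite gram_areaE ler_pdivrMr//; apply: (le_trans h).
have v0 := sqr_ge0 (envelope t); have k0 := kappa_ge0.
have hAB : (envelope t ^+ 2) * (envelope t ^+ 2) <=
   (2 * g00 G t) * (2 * kappa * g11 G t) by apply: ler_pM.
have b4 : 0 <= bell (d / 4) t ^+ 4 by rewrite exprn_ge0// ltW// bell_gt0.
have -> : n%:R * n%:R * e ^+ 2 = a ^+ 2 * n%:R ^+ 2 * m ^+ 2 * bell (d / 4) t ^+ 4 *
   (envelope t ^+ 2 * envelope t ^+ 2) by rewrite /e; ring.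
have -> : 2 * a ^+ 2 * n%:R ^+ 2 * m ^+ 2 * kappa * bell (d / 4) t ^+ 4 *
   (g00 G t * g11 G t) * 2 = a ^+ 2 * n%:R ^+ 2 * m ^+ 2 * bell (d / 4) t ^+ 4 *
   (2 * g00 G t * (2 * kappa * g11 G t)) by ring.
apply: ler_wpM2l hAB; apply: mulr_ge0 b4; apply: mulr_ge0 (sqr_ge0 m).
by apply: mulr_ge0; exact: sqr_ge0.
Qed.

(** Isolates the term of (s, s') that should decide its sign, with e bounding all the other
    exponentials. *)
Let rest_le (a : 'I_n) (t e : R) : 0 <= e ->
  (forall j, j != a -> expR (rho j * t) <= e) ->
  `|g01 G t - sigma t 0 a * vel M sigma t 0 a| <= n%:R * (m * e ^+ 2).
Proof.
move=> e0 h; rewrite /= /dotp (bigD1 a)//= addrAC subrr add0r.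
apply: le_trans (ler_norm_sum _ _ _) _.
apply: (@le_trans _ _ (\sum_(j < n | j != a) m * e ^+ 2)).
  apply: ler_sum => j ja; rewrite normrM expr2 [leRHS]mulrCA; apply: ler_pM => //.
    by apply: le_trans (sigma_le t j) _; exact: h.
  by apply: le_trans (vel_le t j) _; apply: ler_wpM2l => //; exact: h.
rewrite mulr_natl -[X in _ *+ X]card_ord -sumr_const.
rewrite [leRHS](bigID (fun j => j != a))/= lerDl.
by apply: sumr_ge0 => j _; rewrite mulr_ge0 ?sqr_ge0.
Qed.

Let g01_pos d : 0 < d -> (forall j, j != top -> rho j <= rho top - d) ->
  \forall t \near +oo, 0 < g01 G t.
Proof.
move=> d0 dtop; near=> t.
have t0 : 0 < t by near: t; exact/nbhs_pinfty_gt/num_real.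
(* The threshold solves n m < 2 d t [rho top]: the leading term exceeds the rest by a factor exp(2 d
   t) >= 1 + 2 d t, up to the constants [rho top] and n m. *)
have ht : n%:R * m / (2 * d * rho top) < t by near: t; exact/nbhs_pinfty_gt/num_real.
have h : forall j, j != top -> expR (rho j * t) <= expR ((rho top - d) * t).
  by move=> j /dtop jt; rewrite ler_expR ler_wpM2r// ltW.
have := rest_le (expR_ge0 _) h.
rewrite {1}/vel sigma_top vel_exp//.
have -> : expR (rho top * t) = expR ((rho top - d) * t) * expR (d * t).
  by rewrite -expRD; congr expR; ring.
have e2 : 1 + 2 * (d * t) <= expR (d * t) ^+ 2.
  by rewrite -expRM_natl; exact: expR_ge1Dx.
rewrite ltr_pdivrMr in ht; last by rewrite !mulr_gt0.
have E0 := exprn_gt0 2 (expR_gt0 ((rho top - d) * t)).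
rewrite ler_norml => /andP[+ _].
set E := expR ((rho top - d) * t) in E0 *; set D := expR (d * t) in e2 *.
have h2 : n%:R * m < rho top * D ^+ 2.
  apply: lt_le_trans (ler_wpM2l (ltW rho_top_gt0) e2).
  have -> : rho top * (1 + 2 * (d * t)) = rho top + t * (2 * d * rho top) by ring.
  by rewrite -[ltLHS]add0r ltrD.
have h3 : n%:R * m * E ^+ 2 < rho top * D ^+ 2 * E ^+ 2 by rewrite ltr_pM2r.
have -> : E * D * (rho top * (E * D)) = rho top * D ^+ 2 * E ^+ 2 by ring.
rewrite mulrA; lra.
Unshelve. all: by end_near. Qed.

Let g01_neg d : 0 < d -> (forall j, j != bot -> rho bot + d <= rho j) ->
  \forall t \near -oo, g01 G t < 0.
Proof.
move=> d0 dbot; near=> t.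
have t0 : t < 0 by near: t; exact/nbhs_ninfty_lt/num_real.
(* The mirror threshold; it is negative because [rho bot] is, and multiplying by that rate reverses
   the inequality. *)
have ht : t < n%:R * m / (2 * d * rho bot) by near: t; exact/nbhs_ninfty_lt/num_real.
have h : forall j, j != bot -> expR (rho j * t) <= expR ((rho bot + d) * t).
  by move=> j /dbot jt; rewrite ler_expR ler_wnM2r// ltW.
have := rest_le (expR_ge0 _) h.
rewrite {1}/vel sigma_bot vel_exp//.
have -> : expR (rho bot * t) = expR ((rho bot + d) * t) * expR (- d * t).
  by rewrite -expRD; congr expR; ring.
have e2 : 1 + 2 * (- d * t) <= expR (- d * t) ^+ 2.
  by rewrite -expRM_natl; exact: expR_ge1Dx.
rewrite ltr_ndivlMr in ht; last by rewrite pmulr_rlt0// mulr_gt0.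
have E0 := exprn_gt0 2 (expR_gt0 ((rho bot + d) * t)).
rewrite ler_norml => /andP[_].
set E := expR ((rho bot + d) * t) in E0 *; set D := expR (- d * t) in e2 *.
have h2 : rho bot * D ^+ 2 < - (n%:R * m).
  apply: le_lt_trans (ler_wnM2l (ltW rho_bot_lt0) e2) _.
  have -> : rho bot * (1 + 2 * (- d * t)) = rho bot - t * (2 * d * rho bot) by ring.
  by rewrite -[ltRHS]add0r ltrD// ltrN2.
have h3 : rho bot * D ^+ 2 * E ^+ 2 < - (n%:R * m) * E ^+ 2 by rewrite ltr_pM2r.
have -> : E * D * (rho bot * (E * D)) = rho bot * D ^+ 2 * E ^+ 2 by ring.
rewrite mulrA; lra.
Unshelve. all: by end_near. Qed.

Lemma dominated_curve_tame : exists b c, tame (gram_of M sigma) b c.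
Proof.
have [d d0 [dtop dbot]] := ex_gap.
have k0 := kappa_ge0; have m0 := m_ge0; have n0 := ler0n R n.
pose c1 := 2 * n%:R * kappa; pose c2 := 2 * n%:R * m ^+ 2.
pose c3 := mu ^+ 2 * (n * n)%:R; pose c4 := 2 * 32 ^+ 2 * n%:R ^+ 2 * m ^+ 2 * kappa.
have c10 : 0 <= c1 by rewrite mulr_ge0// mulr_ge0.
have c20 : 0 <= c2 by rewrite mulr_ge0 ?sqr_ge0// mulr_ge0.
have c30 : 0 <= c3 by rewrite mulr_ge0// sqr_ge0.
have c40 : 0 <= c4.
  apply: mulr_ge0 k0; apply: mulr_ge0 (sqr_ge0 m); apply: mulr_ge0 (sqr_ge0 _).
  by apply: mulr_ge0; rewrite ?exprn_ge0.
(* The sum exceeds every individual constant, and the leading 1 gives c <= c^2, so one c serves the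
   linear and the squared bounds of [tame]. *)
pose c := 1 + (c1 + c2 + c3 + c4).
have c0 : 0 <= c by rewrite /c; lra.
have cc : c <= c ^+ 2 by rewrite /c; nra.
have lv := is_derive_vel lin; have la := is_derive_acc lin.
exists (d / 4), c; split => //.
- by rewrite divr_gt0.
- move=> t; apply: is_derive_eq (is_derive_dotp (lin t) (lin t)) _.
  by rewrite dotpC /=; ring.
- move=> t; exact: is_derive_dotp (lin t) (lv t).
- move=> t; apply: is_derive_eq (is_derive_dotp (lv t) (lv t)) _.
  by rewrite dotpC /=; ring.
- exact: continuous_dotp lin la.
- exact: continuous_dotp lv la.
- move=> t; apply: (le_trans (g00_le t)).
  apply: (@le_trans _ _ (c1 * g11 G t)).
    by have := ler_wpM2l n0 (g11_ge t); rewrite /c1; lra.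
  apply: ler_wpM2r; last by apply: le_trans cc; rewrite /c; lra.
  by apply: sumr_ge0 => j _; rewrite -expr2 sqr_ge0.
- move=> t; apply: (le_trans (g11_le t)).
  have nm0 : 0 <= n%:R * m ^+ 2 by rewrite mulr_ge0 ?sqr_ge0.
  apply: (@le_trans _ _ (c2 * g00 G t)).
    by have := ler_wpM2l nm0 (g00_ge t); rewrite /c2; lra.
  apply: ler_wpM2r; first exact: ltW.
  by apply: le_trans cc; rewrite /c; lra.
- move=> t; apply: (le_trans (turn_le t)).
  by apply: ler_wpM2r; [exact: ltW|rewrite -/c3 /c; lra].
- move=> t; apply: (le_trans (area_le t d0 dtop dbot)).
  rewrite -/c4 exprMn -exprM; apply: ler_wpM2r.
    apply: mulr_ge0; first exact: ltW.
    by apply: sumr_ge0 => j _; rewrite -expr2 sqr_ge0.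
  apply: ler_wpM2r; first by rewrite exprn_ge0// ltW// bell_gt0.
  by apply: le_trans cc; rewrite /c; lra.
- exact: g01_pos d0 dtop.
- exact: g01_neg d0 dbot.
Qed.

End DominatedCurve.

(** * The curve of an operator *)

Section AssocCurve.
Variables (R : realType) (k p : nat).
Variables (r : 'I_k -> R) (x y : 'I_p -> R).
Let sigma := assoc_curve r x y.

(** The growth exponent of each coordinate: the root itself if real, the common real part for both
    members of a conjugate pair. The block layout copies that of [assoc_curve]. *)
Definition rate : 'I_(k + p * 2) -> R :=
  row_mx (\row_j r j) (mxvec (\matrix_(j < p, _ < 2) x j)) 0.

Lemma rate_real i : rate (lshift _ i) = r i.
Proof. by rewrite /rate row_mxEl mxE. Qed.

Lemma rate_complex i c : rate (rshift _ (mxvec_index i c)) = x i.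
Proof. by rewrite /rate row_mxEr mxvecE mxE. Qed.

Lemma assoc_curve_real t i : sigma t 0 (lshift _ i) = expR (r i * t).
Proof. by rewrite /sigma /assoc_curve row_mxEl mxE. Qed.

Lemma assoc_curve_complex t i c : sigma t 0 (rshift _ (mxvec_index i c)) =
  expR (x i * t) * (if c == 0 then cos (y i * t) else sin (y i * t)).
Proof. by rewrite /sigma /assoc_curve row_mxEr mxvecE mxE. Qed.

Lemma assoc_curve_le t j : `|sigma t 0 j| <= expR (rate j * t).
Proof.
case: (split_ordP j) => [i ->|c ->].
  by rewrite rate_real assoc_curve_real ger0_norm ?expR_ge0.
case/mxvec_indexP: c => i c; rewrite rate_complex assoc_curve_complex.
rewrite normrM ger0_norm ?expR_ge0// ler_piMr ?expR_ge0//.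
by case: ifP => _; [exact: cos_max|exact: sin_max].
Qed.

Lemma mulmx_delta n (u : 'rV[R]_n) j : (u *m delta_mx j (0 : 'I_1)) 0 0 = u 0 j.
Proof. by rewrite -colE mxE. Qed.

Lemma mulmx_delta2 n (u : 'rV[R]_n) (a b : R) i j :
  (u *m (a *: delta_mx i (0 : 'I_1) + b *: delta_mx j (0 : 'I_1))) 0 0 =
  a * u 0 i + b * u 0 j.
Proof.
by rewrite mulmxDr -!scalemxAr [LHS]mxE; congr (_ + _);
  rewrite [LHS]mxE mulmx_delta.
Qed.

(* Each coordinate has a derivative that is a combination of itself and of its
   companion in the same conjugate pair. *)
Lemma assoc_curve_column j : exists ac : 'cV[R]_(k + p * 2) * R,
  (forall t : R, is_derive t 1 (fun t => sigma t 0 j) ((sigma t *m ac.1) 0 0)) /\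
  (forall t, `|(sigma t *m ac.1) 0 0| <= ac.2 * expR (rate j * t)).
Proof.
case: (split_ordP j) => [i ->|c ->].
  exists (r i *: delta_mx (lshift _ i) 0, `|r i|) => /=; split => t.
    rewrite -scalemxAr mxE mulmx_delta assoc_curve_real.
    rewrite (_ : (fun t => _) = fun t => expR (r i * t)).
      exact: is_derive_expRM.
    by apply/funext => s; rewrite assoc_curve_real.
  rewrite -scalemxAr mxE mulmx_delta assoc_curve_real rate_real normrM.
  by rewrite (ger0_norm (expR_ge0 _)).
case/mxvec_indexP: c => i c.
have lin (a t : R) : is_derive t 1 (fun t : R => a * t) a.
  by apply: is_derive_eq (is_derive_mul (is_derive_const a t) (is_derive_id t 1)) _; ring.
pose e c' := delta_mx (rshift k (mxvec_index i c')) 0 : 'cV[R]_(k + p * 2).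
have main (a b : R) t c' : `|(sigma t *m (a *: e 0 + b *: e 1)) 0 0| <=
    (`|a| + `|b|) * expR (rate (rshift k (mxvec_index i c')) * t).
  rewrite /e mulmx_delta2.
  apply: (le_trans (ler_normD _ _)); rewrite !normrM mulrDl; apply: lerD.
    by apply: ler_wpM2l => //; rewrite rate_complex -(rate_complex i 0) assoc_curve_le.
  by apply: ler_wpM2l => //; rewrite rate_complex -(rate_complex i 1) assoc_curve_le.
have [->|->] := ord2_cases c.
- exists (x i *: e 0 + (- y i) *: e 1, `|x i| + `|- y i|); split=> t /=.
    rewrite /e mulmx_delta2 !assoc_curve_complex /=.
    rewrite (_ : (fun t => _) = fun t => expR (x i * t) * cos (y i * t)).
      have h := is_derive_mul (is_derive_expRM (x i) t)
        (is_derive1_comp (is_derive_cos (y i * t)) (lin (y i) t)).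
      by apply: is_derive_eq h _ => /=; ring.
    by apply/funext => s; rewrite assoc_curve_complex.
  by have := main (x i) (- y i) t 0; rewrite !rate_complex.
- exists (y i *: e 0 + x i *: e 1, `|y i| + `|x i|); split=> t /=.
    rewrite /e mulmx_delta2 !assoc_curve_complex /=.
    rewrite (_ : (fun t => _) = fun t => expR (x i * t) * sin (y i * t)).
      have h := is_derive_mul (is_derive_expRM (x i) t)
        (is_derive1_comp (is_derive_sin (y i * t)) (lin (y i) t)).
      by apply: is_derive_eq h _ => /=; ring.
    by apply/funext => s; rewrite assoc_curve_complex.
  by have := main (y i) (x i) t 0; rewrite !rate_complex.
Qed.

Lemma assoc_curve_tame n (P : ode_operator R n) :
  roots_listing P r x y -> real_roots_dominant P r ->
  exists M, linear_curve M sigma /\ exists b c, tame (gram_of M sigma) b c.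
Proof.
move=> [r_dec y_gt0 _ rootsP] [first [last [first0 last0 [rf rf_max] [rl rl_min]]]].
(* The chosen columns are assembled into one matrix M below, and the finitely many bounds into their
   maximum m. *)
have [f fP] := choice assoc_curve_column.
pose M : 'M[R]_(k + p * 2) := \matrix_(i, j) (f j).1 i 0.
have ME t j : (sigma t *m M) 0 j = (sigma t *m (f j).1) 0 0.
  by rewrite !mxE; apply: eq_bigr => i _; rewrite !mxE.
have lin : linear_curve M sigma by move=> t j; rewrite ME; exact: (fP j).1.
exists M; split=> //.
pose m := \big[Num.max/0]_j (f j).2.
(* Dominance compares a root only with roots other than the extreme one, so the non-real roots must
   first be told apart from every real number. *)
have non_real i : roots_set P (x i +i* y i)%C /\ forall a, (x i +i* y i)%C <> a%:C%C.
  split; first by rewrite rootsP; left; right; exists i.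
  by move=> a [_ /eqP]; rewrite gt_eqF.
apply: (dominated_curve_tame (rho := rate) (m := m) (top := lshift _ first)
  (bot := lshift _ last) lin assoc_curve_le).
- move=> t j; rewrite ME; apply: (le_trans ((fP j).2 t)).
  apply: ler_wpM2r; first exact: expR_ge0.
  exact: (le_bigmax _ (fun j => (f j).2) j).
- by move=> t; rewrite assoc_curve_real rate_real.
- by move=> t; rewrite assoc_curve_real rate_real.
- by rewrite rate_real.
- by rewrite rate_real.
- move=> j; rewrite rate_real; case: (split_ordP j) => [i ->|c ->].
    rewrite rate_real => jf; apply: r_dec.
    rewrite first0 lt0n; apply: contra_neq jf => i0.
    by congr lshift; apply/val_inj; rewrite /= i0 first0.
  case/mxvec_indexP: c => i c _; rewrite rate_complex.
  by have [ri nr] := non_real i; exact: rf_max ri (nr _).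
- move=> j; rewrite rate_real; case: (split_ordP j) => [i ->|c ->].
    rewrite rate_real => jl; apply: r_dec.
    (* The presence of i makes k positive, so [k.-1] is the largest index. *)
    rewrite last0 ltn_neqAle -ltnS (ltn_predK (ltn_ord i)) ltn_ord andbT.
    apply: contra_neq jl => i0.
    by congr lshift; apply/val_inj; rewrite /= i0 last0.
  case/mxvec_indexP: c => i c _; rewrite rate_complex.
  by have [ri nr] := non_real i; exact: rl_min ri (nr _).
Qed.

End AssocCurve.

(** * The metric of the surface *)

Section Surface.
Variable R : realType.
Implicit Types (X Y : gram R) (u v : R).

Lemma dotp_tensor m n (a a' : 'rV[R]_m) (b b' : 'rV[R]_n) :
  dotp (tensor a b) (tensor a' b') = dotp a a' * dotp b b'.
Proof.
rewrite /dotp big_distrlr /= pair_bigA /=.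
rewrite (reindex _ (curry_mxvec_bij m n)) /=; apply: eq_bigr => -[i j] _ /=.
by rewrite /tensor !mxvecE !mxE !big_ord1 !mxE mulrACA.
Qed.

Definition product_metric X Y : metric R := fun u v => \matrix_(i, j)
  if i == 0 then if j == 0 then g11 X u * g00 Y v else g01 X u * g01 Y v
  else if j == 0 then g01 X u * g01 Y v else g00 X u * g11 Y v.

Lemma tensor_coord m n (a : 'rV[R]_m) (b : 'rV[R]_n) i j :
  tensor a b 0 (mxvec_index i j) = a 0 i * b 0 j.
Proof. by rewrite mxvecE mxE big_ord1 mxE. Qed.

Lemma pderiv0_surface m n (M : 'M[R]_m) (s1 : R -> 'rV[R]_m) (s2 : R -> 'rV[R]_n) u v :
  linear_curve M s1 ->
  pderiv 0 (assoc_surface s1 s2) u v = tensor (vel M s1 u) (s2 v).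
Proof.
move=> l1; rewrite /pderiv eqxx.
suff h (t : R) j : is_derive t 1
    (fun t => (assoc_surface s1 s2 ^~ v) t 0 j) (tensor (vel M s1 t) (s2 v) 0 j).
  by rewrite (derive1_rV h).
rewrite /assoc_surface; case/mxvec_indexP: j => i j; rewrite tensor_coord.
rewrite (_ : (fun t => _) = (fun t => s1 t 0 i * s2 v 0 j)); last first.
  by apply/funext => x; rewrite tensor_coord.
by apply: is_derive_eq (is_derive_mul (l1 t i) (is_derive_const (s2 v 0 j) t)) _; ring.
Qed.

Lemma pderiv1_surface m n (M : 'M[R]_n) (s1 : R -> 'rV[R]_m) (s2 : R -> 'rV[R]_n) u v :
  linear_curve M s2 ->
  pderiv 1 (assoc_surface s1 s2) u v = tensor (s1 u) (vel M s2 v).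
Proof.
move=> l1; rewrite /pderiv /=.
suff h (t : R) j : is_derive t 1
    (fun t => assoc_surface s1 s2 u t 0 j) (tensor (s1 u) (vel M s2 t) 0 j).
  by rewrite (derive1_rV h).
rewrite /assoc_surface; case/mxvec_indexP: j => i j; rewrite tensor_coord.
rewrite (_ : (fun t => _) = (fun t => s1 u 0 i * s2 t 0 j)); last first.
  by apply/funext => x; rewrite tensor_coord.
by apply: is_derive_eq (is_derive_mul (is_derive_const (s1 u 0 i) t) (l1 t j)) _; ring.
Qed.

Lemma induced_metricE m n (M : 'M[R]_m) (N : 'M[R]_n)
    (s1 : R -> 'rV[R]_m) (s2 : R -> 'rV[R]_n) :
  linear_curve M s1 -> linear_curve N s2 ->
  induced_metric (assoc_surface s1 s2) =
  product_metric (gram_of M s1) (gram_of N s2).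
Proof.
move=> l1 l2; apply/funext => u; apply/funext => v; apply/matrixP => i j.
rewrite !mxE; have [->|->] := ord2_cases i; have [->|->] := ord2_cases j => /=;
  rewrite ?(pderiv0_surface _ _ _ l1) ?(pderiv1_surface _ _ _ l2) dotp_tensor //.
- by rewrite (dotpC (vel M s1 u)).
- by rewrite (dotpC (vel N s2 v)).
Qed.

Lemma invmx22 (A : 'M[R]_2) : \det A != 0 ->
  [/\ invmx A 0 0 = A 1 1 / \det A, invmx A 0 1 = - A 0 1 / \det A,
      invmx A 1 0 = - A 1 0 / \det A & invmx A 1 1 = A 0 0 / \det A].
Proof.
move=> d0; have uA : A \in unitmx by rewrite unitmxE unitfE.
have l0 : lift 0 0 = 1 :> 'I_2 by exact/val_inj.
have l1 : lift 1 0 = 0 :> 'I_2 by exact/val_inj.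
rewrite /invmx uA; split; rewrite !mxE /cofactor det_mx11 !mxE ?l0 ?l1 /=.
all: by rewrite ?expr0 ?expr1 ?expr2 mulrC; congr (_ / _); ring.
Qed.

Lemma pderiv0E (f : R -> R -> R) u v d :
  is_derive u 1 (f ^~ v) d -> pderiv 0 f u v = d.
Proof. by move=> [_ <-]; rewrite /pderiv eqxx derive1E. Qed.

Lemma pderiv1E (f : R -> R -> R) u v d :
  is_derive v 1 (f u) d -> pderiv 1 f u v = d.
Proof. by move=> [_ <-]; rewrite /pderiv /= derive1E. Qed.

(** * Christoffel symbols and Gauss curvature of the metric *)

Section Curvature.
Variables (X Y : gram R) (b c b' c' : R).
Hypotheses (tX : tame X b c) (tY : tame Y b' c').

Let g := product_metric X Y.

Let det_g u v : \det (g u v) = gram_det X Y u v.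
Proof. by rewrite det_mx22 !mxE /= /gram_det; ring. Qed.

Let G_neq0 u v : gram_det X Y u v != 0.
Proof. by rewrite gt_eqF// (gram_det_gt0 tX tY). Qed.

(* Gamma0 and Gamma1 are the Christoffel symbols of the first kind, the lowered
   index being 0 or 1. *)
Let Gamma0 (i j : 'I_2) u v : R :=
  if i == 0 then if j == 0 then g12 X u * g00 Y v else g11 X u * g01 Y v
  else if j == 0 then g11 X u * g01 Y v else g01 X u * g02 Y v.
Let Gamma1 (i j : 'I_2) u v : R :=
  if i == 0 then if j == 0 then g02 X u * g01 Y v else g01 X u * g11 Y v
  else if j == 0 then g01 X u * g11 Y v else g00 X u * g12 Y v.

Let du00 u v : pderiv 0 (fun u v => g u v 0 0) u v = 2 * g12 X u * g00 Y v.
Proof.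
apply: pderiv0E; rewrite (_ : (fun _ => _) = fun u => g11 X u * g00 Y v); last first.
  by apply/funext => t; rewrite mxE.
by apply: is_derive_eq (is_derive_mul (tame_d11 tX u) (is_derive_const _ u)) _; ring.
Qed.

Let dv00 u v : pderiv 1 (fun u v => g u v 0 0) u v = 2 * g11 X u * g01 Y v.
Proof.
apply: pderiv1E; rewrite (_ : (fun _ => _) = fun v => g11 X u * g00 Y v); last first.
  by apply/funext => t; rewrite mxE.
by apply: is_derive_eq (is_derive_mul (is_derive_const _ v) (tame_d00 tY v)) _; ring.
Qed.

Let du11 u v : pderiv 0 (fun u v => g u v 1 1) u v = 2 * g01 X u * g11 Y v.
Proof.
apply: pderiv0E; rewrite (_ : (fun _ => _) = fun u => g00 X u * g11 Y v); last first.
  by apply/funext => t; rewrite mxE.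
by apply: is_derive_eq (is_derive_mul (tame_d00 tX u) (is_derive_const _ u)) _; ring.
Qed.

Let dv11 u v : pderiv 1 (fun u v => g u v 1 1) u v = 2 * g00 X u * g12 Y v.
Proof.
apply: pderiv1E; rewrite (_ : (fun _ => _) = fun v => g00 X u * g11 Y v); last first.
  by apply/funext => t; rewrite mxE.
by apply: is_derive_eq (is_derive_mul (is_derive_const _ v) (tame_d11 tY v)) _; ring.
Qed.

Let du01 u v : pderiv 0 (fun u v => g u v 0 1) u v =
  (g11 X u + g02 X u) * g01 Y v.
Proof.
apply: pderiv0E; rewrite (_ : (fun _ => _) = fun u => g01 X u * g01 Y v); last first.
  by apply/funext => t; rewrite mxE.
by apply: is_derive_eq (is_derive_mul (tame_d01 tX u) (is_derive_const _ u)) _; ring.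
Qed.

Let dv01 u v : pderiv 1 (fun u v => g u v 0 1) u v =
  g01 X u * (g11 Y v + g02 Y v).
Proof.
apply: pderiv1E; rewrite (_ : (fun _ => _) = fun v => g01 X u * g01 Y v); last first.
  by apply/funext => t; rewrite mxE.
by apply: is_derive_eq (is_derive_mul (is_derive_const _ v) (tame_d01 tY v)) _; ring.
Qed.

Let g10 : (fun u v => g u v 1 0) = (fun u v => g u v 0 1).
Proof. by apply/funext => u; apply/funext => v; rewrite !mxE. Qed.

Let christoffel0 i j u v : christoffel g 0 i j u v =
  (g00 X u * g11 Y v * Gamma0 i j u v - g01 X u * g01 Y v * Gamma1 i j u v)
  / gram_det X Y u v.
Proof.
have dN0 : \det (g u v) != 0 by rewrite det_g.
have [i00 i01 _ _] := invmx22 dN0.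
rewrite /christoffel !big_ord_recl big_ord0 addr0.
have -> : lift ord0 ord0 = 1 :> 'I_2 by exact/val_inj.
rewrite i00 i01 det_g !mxE /= /Gamma0 /Gamma1.
by have [->|->] := ord2_cases i; have [->|->] := ord2_cases j => /=;
  rewrite ?g10 ?(du00, dv00, du01, dv01, du11, dv11); field.
Qed.

Let christoffel1 i j u v : christoffel g 1 i j u v =
  (g11 X u * g00 Y v * Gamma1 i j u v - g01 X u * g01 Y v * Gamma0 i j u v)
  / gram_det X Y u v.
Proof.
have dN0 : \det (g u v) != 0 by rewrite det_g.
have [_ _ i10 i11] := invmx22 dN0.
rewrite /christoffel !big_ord_recl big_ord0 addr0.
have -> : lift ord0 ord0 = 1 :> 'I_2 by exact/val_inj.
rewrite i10 i11 det_g !mxE /= /Gamma0 /Gamma1.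
by have [->|->] := ord2_cases i; have [->|->] := ord2_cases j => /=;
  rewrite ?g10 ?(du00, dv00, du01, dv01, du11, dv11); field.
Qed.

Let is_derive_det_u u v : is_derive u 1 (gram_det X Y ^~ v)
  (2 * (g00 Y v * g11 Y v * (g01 X u * g11 X u + g00 X u * g12 X u)
        - g01 Y v ^+ 2 * g01 X u * (g11 X u + g02 X u))).
Proof.
rewrite (_ : gram_det X Y ^~ v = gram_det Y X v); last first.
  by apply/funext => t; exact: gram_detC.
exact: is_derive_gram_det tX v u.
Qed.

(** The curvature component needs only the u-derivatives of the symbols with lower indices 1 1 and
    the v-derivatives of those with 0 1. In the variable of differentiation these contain no [g02]
    or [g12], so no third derivative of a curve appears. The common factors of each numerator are
    collected before differentiating. *)
Let d0_Gamma0 u v : pderiv 0 (christoffel g 0 1 1) u v =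
  (((g01 X u *+ 2 * g01 X u + g00 X u * (g11 X u + g02 X u))
      * (g11 Y v * g02 Y v - g01 Y v * g12 Y v)) * gram_det X Y u v
   - g00 X u * g01 X u * (g11 Y v * g02 Y v - g01 Y v * g12 Y v)
     * (2 * (g00 Y v * g11 Y v * (g01 X u * g11 X u + g00 X u * g12 X u)
        - g01 Y v ^+ 2 * g01 X u * (g11 X u + g02 X u)))) / gram_det X Y u v ^+ 2.
Proof.
apply: pderiv0E.
rewrite (_ : (fun _ => _) = fun u => g00 X u * g01 X u
  * (g11 Y v * g02 Y v - g01 Y v * g12 Y v) / gram_det X Y u v); last first.
  by apply/funext => t; rewrite christoffel0 /Gamma0 /Gamma1 /=; congr (_ / _); ring.
have h := is_derive_mul (is_derive_mul (tame_d00 tX u) (tame_d01 tX u))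
  (is_derive_const (g11 Y v * g02 Y v - g01 Y v * g12 Y v) u).
apply: is_derive_eq (@is_derive_div R _ (gram_det X Y ^~ v) u _ _
  (G_neq0 u v) h (is_derive_det_u u v)) _.
by congr (_ / _); ring.
Qed.

Let d0_Gamma1 u v : pderiv 0 (christoffel g 1 1 1) u v =
  ((((2 * g01 X u * g11 X u + g00 X u * (2 * g12 X u)) * (g00 Y v * g12 Y v)
      - 2 * g01 X u * (g11 X u + g02 X u) * (g01 Y v * g02 Y v))) * gram_det X Y u v
   - (g00 X u * g11 X u * (g00 Y v * g12 Y v) - g01 X u ^+ 2 * (g01 Y v * g02 Y v))
     * (2 * (g00 Y v * g11 Y v * (g01 X u * g11 X u + g00 X u * g12 X u)
        - g01 Y v ^+ 2 * g01 X u * (g11 X u + g02 X u)))) / gram_det X Y u v ^+ 2.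
Proof.
apply: pderiv0E.
rewrite (_ : (fun _ => _) = fun u => (g00 X u * g11 X u * (g00 Y v * g12 Y v)
  - g01 X u * g01 X u * (g01 Y v * g02 Y v)) / gram_det X Y u v); last first.
  by apply/funext => t; rewrite christoffel1 /Gamma0 /Gamma1 /=; congr (_ / _); ring.
have h := is_derive_sub
  (is_derive_mul (is_derive_mul (tame_d00 tX u) (tame_d11 tX u))
    (is_derive_const (g00 Y v * g12 Y v) u))
  (is_derive_mul (is_derive_mul (tame_d01 tX u) (tame_d01 tX u))
    (is_derive_const (g01 Y v * g02 Y v) u)).
apply: is_derive_eq (@is_derive_div R _ (gram_det X Y ^~ v) u _ _
  (G_neq0 u v) h (is_derive_det_u u v)) _.
by congr (_ / _); ring.
Qed.

Let d1_Gamma0 u v : pderiv 1 (christoffel g 0 0 1) u v =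
  (gram_area X u * (2 * g12 Y v * g01 Y v + g11 Y v * (g11 Y v + g02 Y v))
    * gram_det X Y u v
   - gram_area X u * (g11 Y v * g01 Y v)
     * (2 * (g00 X u * g11 X u * (g01 Y v * g11 Y v + g00 Y v * g12 Y v)
        - g01 X u ^+ 2 * g01 Y v * (g11 Y v + g02 Y v)))) / gram_det X Y u v ^+ 2.
Proof.
apply: pderiv1E.
rewrite (_ : christoffel g 0 0 1 u = fun v => gram_area X u * (g11 Y v * g01 Y v)
   / gram_det X Y u v); last first.
  apply/funext => t; rewrite christoffel0 /Gamma0 /Gamma1 /=; congr (_ / _).
  by rewrite /gram_area; ring.
have h := is_derive_mul (is_derive_const (gram_area X u) v)
  (is_derive_mul (tame_d11 tY v) (tame_d01 tY v)).
apply: is_derive_eq (@is_derive_div R _ (gram_det X Y u) v _ _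
  (G_neq0 u v) h (is_derive_gram_det X tY u v)) _.
by congr (_ / _); ring.
Qed.

Let d1_Gamma1 u v : pderiv 1 (christoffel g 1 0 1) u v =
  (g11 X u * g01 X u * (2 * (g00 Y v * g12 Y v - g01 Y v * g02 Y v))
    * gram_det X Y u v
   - g11 X u * g01 X u * gram_area Y v
     * (2 * (g00 X u * g11 X u * (g01 Y v * g11 Y v + g00 Y v * g12 Y v)
        - g01 X u ^+ 2 * g01 Y v * (g11 Y v + g02 Y v)))) / gram_det X Y u v ^+ 2.
Proof.
apply: pderiv1E.
rewrite (_ : christoffel g 1 0 1 u = fun v => g11 X u * g01 X u * gram_area Y v
   / gram_det X Y u v); last first.
  apply/funext => t; rewrite christoffel1 /Gamma0 /Gamma1 /=; congr (_ / _).
  by rewrite /gram_area; ring.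
have h := is_derive_mul (is_derive_const (g11 X u * g01 X u) v)
  (is_derive_gram_area tY v).
apply: is_derive_eq (@is_derive_div R _ (gram_det X Y u) v _ _
  (G_neq0 u v) h (is_derive_gram_det X tY u v)) _.
by congr (_ / _); ring.
Qed.

Lemma gauss_curvature_product_metric u v : gauss_curvature g u v =
  (g00 X u * gram_turn X u * (g00 Y v * gram_turn Y v)
   - g11 X u * gram_area X u * (g11 Y v * gram_area Y v)) / gram_det X Y u v ^+ 2.
Proof.
rewrite /gauss_curvature det_g /riemann !big_ord_recl !big_ord0 !addr0.
have -> : lift ord0 ord0 = 1 :> 'I_2 by exact/val_inj.
have -> : ord0 = 0 :> 'I_2 by exact/val_inj.
rewrite d0_Gamma0 d0_Gamma1 d1_Gamma0 d1_Gamma1 !christoffel0 !christoffel1.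
rewrite !mxE /= /Gamma0 /Gamma1 /= /gram_turn /gram_area.
have := G_neq0 u v; rewrite /gram_det.
(* With the values generalized, the claim is a rational identity in ten indeterminates whose only
   denominator is the determinant. *)
move: (g00 X u) (g01 X u) (g11 X u) (g02 X u) (g12 X u) => A C B P Q.
move: (g00 Y v) (g01 Y v) (g11 Y v) (g02 Y v) (g12 Y v) => D F E p q G0.
by field; rewrite exprMn.
Qed.

Lemma curvature_times_area u v :
  gauss_curvature g u v * area_density g u v = curvature_density X Y u v.
Proof.
rewrite gauss_curvature_product_metric /area_density !mxE /=.
have -> : g11 X u * g00 Y v * (g00 X u * g11 Y v) - (g01 X u * g01 Y v) ^+ 2 =
  gram_det X Y u v by rewrite /gram_det; ring.
have G0 := gram_det_gt0 tX tY u v.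
have s0 : 0 < Num.sqrt (gram_det X Y u v) by rewrite sqrtr_gt0.
rewrite /curvature_density.
(* Writing G as s^2 reduces the identity to s / s^4 = 1 / s^3. *)
rewrite -{1 3}(sqr_sqrtr (ltW G0)).
move: (Num.sqrt (gram_det X Y u v)) s0 => s s0.
by field; rewrite gt_eqF.
Qed.

End Curvature.
End Surface.

Theorem theorem1p11 (R : realType) (n1 n2 : nat)
    (P1 : ode_operator R n1) (P2 : ode_operator R n2)
    (n1_ge2 : (2 <= n1)%N) (n2_ge2 : (2 <= n2)%N)
    (k p : nat) (r : 'I_k -> R) (x y : 'I_p -> R)
    (l q : nat) (s : 'I_l -> R) (z w : 'I_q -> R)
    (simple1 : all_roots_simple P1) (simple2 : all_roots_simple P2)
    (roots1 : roots_listing P1 r x y) (roots2 : roots_listing P2 s z w)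
    (dominant1 : real_roots_dominant P1 r)
    (dominant2 : real_roots_dominant P2 s) :
  let sigma1 := assoc_curve r x y in
  let sigma2 := assoc_curve s z w in
  let Sigma := assoc_surface sigma1 sigma2 in
  (0 = total_gauss_curvature Sigma - 2%:E * Theta sigma1 - 2%:E * Theta sigma2
       + (2 * pi)%:E)%E.
Proof.
move=> sigma1 sigma2 Sigma.
have [M [lin1 [b [c t1]]]] := assoc_curve_tame roots1 dominant1.
have [N [lin2 [b' [c' t2]]]] := assoc_curve_tame roots2 dominant2.
(* The 0 on the left is expanded into the Gram form, after which the two sides agree integrand by
   integrand. *)
rewrite [LHS](gauss_bonnet_gram t1 t2).
rewrite /total_gauss_curvature /Sigma (induced_metricE lin1 lin2) /Theta.
congr (_ - _ * _ - _ * _ + _)%E; apply: eq_integral => t _; congr _%:E.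
- by rewrite (curvature_times_area t1 t2).
- by rewrite (theta_integrandE lin1).
- by rewrite (theta_integrandE lin2).
Qed.
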